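(* Let $\mathbf{X}=\mathbf{S}(\mathbf{h})\subset\mathbb{R}^n$, $\mathbf{K}=[-1,1]^n=\mathbf{S}(\mathbf{f})$ with $\mathbf{f}=(1-x_1^2,\ldots,1-x_n^2)$, and let $\mathrm{d}_{\mathbf{X}}^\ell$ be the SoS hierarchy values for the volume $\lambda(\mathbf{X})$ as in the context. Put $\gamma(n,\mathbf{f},\mathbf{h})=\max(\gamma(n,\mathbf{f}),\gamma(n,\mathbf{h}))$ and $\widehat{\text{\L}}=\max\{\text{\L},1\}$, where $\text{\L}$ is the Łojasiewicz exponent of $\mathbf{h}$. Suppose the finite one-sided Gibbs phenomenon condition of the context holds with constant $c_G$. Then there exists $C>0$ such that for all $\varepsilon\in(0,1)$ one has $\mathrm{d}_{\mathbf{X}}^\ell-\lambda(\mathbf{X})<\varepsilon$ for any $$\ell\ \ge\ \gamma(n,\mathbf{f},\mathbf{h})\left(\frac{C}{\varepsilon}\right)^{3.5n\widehat{\text{\L}}}\left(1+2^{n+1}\frac{c_G}{\varepsilon}\right)^{2.5n\widehat{\text{\L}}}\in\mathcal{O}\left(\frac{1}{\varepsilon^{6n\widehat{\text{\L}}}}\right).$$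
   Context: For $\mathbf{h}=(h_1,\ldots,h_r)\in\mathbb{R}[\mathbf{x}]^r$, $\mathbf{x}\in\mathbb{R}^n$, let $\mathbf{S}(\mathbf{h})=\{\mathbf{x}\in\mathbb{R}^n: h_i(\mathbf{x})\ge 0\ \forall i\}$. Let $\Sigma[\mathbf{x}]$ be the cone of finite sums of squares of polynomials, $\mathcal{Q}(\mathbf{h})=\{\sigma_{r+1}+\sum_{i=1}^r\sigma_i h_i:\sigma_i\in\Sigma[\mathbf{x}]\}$, and $\mathcal{Q}_\ell(\mathbf{h})$ the subset of those elements admitting such a representation with $\deg(\sigma_i h_i)\le 2\ell$ for $i\le r$ and $\deg\sigma_{r+1}\le 2\ell$. Standing assumptions: $\mathbf{X}=\mathbf{S}(\mathbf{h})$ is contained in the closed unit ball, $1-\mathbf{x}^\top\mathbf{x}\in\mathcal{Q}(\mathbf{h})$, and $\max_{[-1,1]^n}|h_i|\le\frac12$ for all $i$. Łojasiewicz exponent of $\mathbf{h}$: an exponent $\text{\L}>0$ such that, for some $\mathfrak{c}>0$ and all $\mathbf{x}\in[-1,1]^n$, $D(\mathbf{x})^{\text{\L}}\le\mathfrak{c}\,H(\mathbf{x})$, where $H(\mathbf{x})=|\min(h_1(\mathbf{x}),\ldots,h_r(\mathbf{x}),0)|$ and $D(\mathbf{x})$ is the Euclidean distance from $\mathbf{x}$ to $\mathbf{S}(\mathbf{h})$. For $\mathbf{f}$ the exponent is $1$. Constants $\gamma$: $\gamma(n,\mathbf{h})\ge1$ is a constant from the effective Putinar Positivstellensatz, i.e.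 such that every polynomial $p$ that is strictly positive on $\mathbf{S}(\mathbf{h})$ belongs to $\mathcal{Q}_\ell(\mathbf{h})$ as soon as $$\ell\ge\gamma(n,\mathbf{h})\,\deg(p)^{3.5n\text{\L}}\left(\frac{\max_{[-1,1]^n}|p|}{\min_{\mathbf{S}(\mathbf{h})}p}\right)^{2.5n\text{\L}};$$ $\gamma(n,\mathbf{f})\ge1$ is the analogous constant for $\mathbf{f}$, with exponent $1$ in place of $\text{\L}$. Hierarchy: with $\lambda$ the Lebesgue measure, and $\mathbb{R}_\ell[\mathbf{x}]$ the polynomials of degree at most $\ell$, $$\mathrm{d}_{\mathbf{X}}^\ell=\inf\Big\{\int_{\mathbf{K}}w\,\mathrm{d}\lambda:\ w\in\mathbb{R}_\ell[\mathbf{x}],\ w-1\in\mathcal{Q}_\ell(\mathbf{h}),\ w\in\mathcal{Q}_\ell(\mathbf{f})\Big\}.$$ Finite one-sided Gibbs phenomenon condition: there exist a constant $c_G\ge0$ depending only on $\mathbf{X}$ and a sequence $(w_d)_{d\in\mathbb{N}}$ of polynomials such that $w_d$ minimizes $\int_{\mathbf{K}}w(\mathbf{x})\,\mathrm{d}\mathbf{x}$ over all $w\in\mathbb{R}_d[\mathbf{x}]$ with $w\ge\mathbf{1}_{\mathbf{X}}$ on $\mathbf{K}$ ($\mathbf{1}_{\mathbf{X}}$ the indicator function of $\mathbf{X}$), and $\max_{\mathbf{K}}w_d\le c_G$ for all $d$. *)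

(* Defs.v *)
From HB Require Import structures.
From mathcomp Require Import all_boot all_order all_algebra.
From mathcomp Require Import all_classical all_reals all_analysis.
From mathcomp Require mpoly.
Import Order.TTheory GRing.Theory Num.Theory numFieldNormedType.Exports.

Set Implicit Arguments.
Unset Strict Implicit.
Unset Printing Implicit Defensive.

Local Open Scope classical_set_scope.
Local Open Scope ring_scope.

Section Space.
Variable R : realType.

(* [measurableTypeR R] is R with its Borel sets, so that the sigma-algebra on
   tuples is the Borel one; [n.-tuple R] would carry another sigma-algebra. *)
Definition Rn (n : nat) := n.-tuple (measurableTypeR R).

(* The n-fold product of the Lebesgue measure of R. *)
Fixpoint lebesgue_Rn (n : nat) : set (Rn n) -> \bar R :=
  match n with
  | 0 => \d_([tuple] : Rn 0)
  | m.+1 => pushforward (@lebesgue_measure R \x lebesgue_Rn (n := m))%E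
              (fun p : measurableTypeR R * Rn m =>
                 [the Rn m.+1 of p.1 :: p.2])
  end.

Variable n : nat.

Definition cube : set (Rn n) := [set x | forall i, -1 <= tnth x i <= 1].

Definition enorm (v : 'I_n -> R) : R := Num.sqrt (\sum_i v i ^+ 2).

(* The value is +oo when A is empty. *)
Definition edist_set (A : set (Rn n)) (x : Rn n) : \bar R :=
  ereal_inf [set (enorm (fun i => tnth x i - tnth y i))%:E | y in A].

End Space.

Arguments cube : clear implicits.

Section PushforwardProduct.
Context d1 d2 d3 (T1 : measurableType d1) (T2 : measurableType d2)
  (T3 : measurableType d3) (R : realType).
Variables (m1 : {sigma_finite_measure set T1 -> \bar R})
  (m2 : {sigma_finite_measure set T2 -> \bar R}).
Variables (c : T1 * T2 -> T3) (mc : measurable_fun setT c).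
Variables (g1 : T3 -> T1) (g2 : T3 -> T2).
Variables (mg1 : measurable_fun setT g1) (mg2 : measurable_fun setT g2).
Variables (gc1 : forall p, g1 (c p) = p.1) (gc2 : forall p, g2 (c p) = p.2).

Let Q := pushforward (m1 \x m2)%E c.
Let Q0 : Q set0 = 0%E.
Proof. by rewrite /Q /pushforward preimage_set0 measure0. Qed.

Let Qge0 A : (0 <= Q A)%E.
Proof. exact: measure_ge0. Qed.

Let Qsa : semi_sigma_additive Q.
Proof.
move=> F mF tF mU; rewrite /Q /pushforward preimage_bigcup.
apply: measure_semi_sigma_additive.
- by move=> n; rewrite -[X in measurable X]setTI; exact: mc.
- apply/trivIsetP => i j _ _ ij; rewrite -preimage_setI.
  move/trivIsetP : tF => /(_ i j Logic.I Logic.I ij) ->.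
  by rewrite preimage_set0.
- by rewrite -preimage_bigcup -[X in measurable X]setTI; exact: mc.
Qed.

HB.instance Definition _ := isMeasure.Build _ _ _ Q Q0 Qge0 Qsa.

Let sQ : sigma_finite setT Q.
Proof.
have [G G1 G2] : sigma_finite setT (m1 \x m2)%E.
  have /sigma_finiteP[F [TF ndF Foo]] := sigma_finiteT m1.
  have /sigma_finiteP[G [TG ndG Goo]] := sigma_finiteT m2.
  exists (fun n => F n `*` G n).
   rewrite -setXTT TF TG predeqE => -[x y]; split.
      move=> [/= [n _ Fnx] [k _ Gky]]; exists (maxn n k) => //; split.
      - by move: x Fnx; exact/subsetPset/ndF/leq_maxl.
      - by move: y Gky; exact/subsetPset/ndG/leq_maxr.
    by move=> [n _ []/= ? ?]; split; exists n.
  move=> k; have [? ?] := Foo k; have [? ?] := Goo k.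
  split; first exact: measurableX.
  by rewrite product_measure1E// lte_mul_pinfty// ge0_fin_numE.
exists (fun k => (fun t => (g1 t, g2 t)) @^-1` G k).
  by rewrite -preimage_bigcup -G1.
move=> k; have [mG fG] := G2 k; split.
  by rewrite -[X in measurable X]setTI; apply: (measurable_fun_pair mg1 mg2).
rewrite /Q /= /pushforward -comp_preimage (_ : _ @^-1` _ = G k) //.
by apply/seteqP; split=> -[x y] /=; rewrite gc1 gc2.
Qed.

HB.instance Definition _ := Measure_isSigmaFinite.Build _ _ _ Q sQ.

Lemma pushforward_product_sigma_finite :
  exists m' : {sigma_finite_measure set T3 -> \bar R},
    pushforward (m1 \x m2)%E c = m'.
Proof. by exists [the {sigma_finite_measure set _ -> \bar R} of Q]. Qed.
End PushforwardProduct.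

Section LebesgueRn.
Variable R : realType.

Lemma lebesgue_Rn_sigma_finite n :
  exists m : {sigma_finite_measure set (Rn R n) -> \bar R},
    @lebesgue_Rn R n = m.
Proof.
elim: n => [|n [m IH]]; first by exists (@dirac _ (Rn R 0) [tuple] R).
have mcons : measurable_fun setT (fun p : measurableTypeR R * Rn R n =>
    [the Rn R n.+1 of p.1 :: p.2]).
  exact: (measurable_cons measurable_fst measurable_snd).
have [||m' E] := @pushforward_product_sigma_finite _ _ _ _ _ _ _
    (@lebesgue_measure R) m _ mcons _ _ (measurable_tnth ord0)
    (@measurable_behead _ (measurableTypeR R) n).
- by case.
- by case=> x y /=; apply/val_inj.
by exists m'; rewrite -E /= IH.
Qed.

Lemma lebesgue_Rn_box n (a b : 'I_n -> R) : (forall i, a i <= b i) ->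
  lebesgue_Rn [set x : Rn R n | forall i, a i <= tnth x i <= b i] =
  (\prod_i (b i - a i))%:E.
Proof.
elim: n a b => [|n IH] a b ab.
  rewrite /= big_ord0 diracE mem_set //= => -[] //.
have [m Hm] := lebesgue_Rn_sigma_finite n.
rewrite big_ord_recl /= /pushforward.
rewrite (_ : _ @^-1` _ = `[a ord0, b ord0] `*`
   [set y : Rn R n | forall i, a (lift ord0 i) <= tnth y i <= b (lift ord0 i)]).
  rewrite Hm product_measure1E //.
  - rewrite -Hm IH //.
    have := @lebesgue_measure_itv R `[a ord0, b ord0]; rewrite /= lte_fin => E.
    rewrite [X in (X * _)%E = _](_ : _ = (b ord0 - a ord0)%:E) -?EFinM //;
      rewrite [LHS]E.
    by case: ltgtP (ab ord0) => // -> _; rewrite subrr.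
  - rewrite (_ : [set _ | _] = \bigcap_(i in [set: 'I_n])
      ((fun y : Rn R n => tnth y i) @^-1` `[a (lift ord0 i), b (lift ord0 i)])).
    apply: fin_bigcap_measurable => // i _.
    by rewrite -[X in measurable X]setTI; exact: measurable_tnth.
    apply/seteqP; split=> y /= H i; last by
      have := H i Logic.I; rewrite /= in_itv.
    by move=> _ /=; rewrite in_itv /=; exact: H.
apply/seteqP; split=> -[x y] /=; rewrite in_itv /=.
  move=> H; split; first exact: (H ord0).
  by move=> i; have := H (lift ord0 i); rewrite tnthS.
by move=> [H1 H2] i; case: (unliftP ord0 i) => [j|] ->; rewrite ?tnthS.
Qed.
End LebesgueRn.

(* mpoly is imported late and without its notations, because both its notations
   and its factory [isMeasure] clash with MathComp-Analysis. In particular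
   [mpoly n R] below is what mpoly.v denotes by {mpoly R[n]}. *)
Import -(notations) mpoly.

Section Polynomials.
Variables (R : realType) (n : nat).
Implicit Types (p w : mpoly n R).

Definition peval p (x : Rn R n) : R := meval (tnth x) p.

(* [msize p] is one more than the total degree of p, and [msize 0 = 0]. *)
Definition deg_le p (d : nat) : Prop := (msize p <= d.+1)%N.

Definition deg p : nat := (msize p).-1.

Definition pX (i : 'I_n) : mpoly n R := mpolyX R (mnm1 i).

Definition max_cube p : R := sup [set peval p x | x in cube R n].

Definition max_abs_cube p : R := sup [set `|peval p x| | x in cube R n].

Definition integral_cube p : \bar R :=
  (\int[@lebesgue_Rn R n]_(x in cube R n) (peval p x)%:E)%E.

Definition is_sos p : Prop :=
  exists s : seq (mpoly n R), p = \sum_(q <- s) q ^+ 2.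

Definition ball_poly : mpoly n R := 1 - \sum_i pX i ^+ 2.

Definition cube_polys (i : 'I_n) : mpoly n R := 1 - pX i ^+ 2.

Section System.
Variables (r : nat) (h : 'I_r -> mpoly n R).

Definition semialg : set (Rn R n) := [set x | forall i, 0 <= peval (h i) x].

Definition quadratic_module : set (mpoly n R) :=
  [set p | exists (s0 : mpoly n R) (s : 'I_r -> mpoly n R),
     [/\ is_sos s0, forall i, is_sos (s i) & p = s0 + \sum_i s i * h i]].

Definition truncated_quadratic_module (l : nat) : set (mpoly n R) :=
  [set p | exists (s0 : mpoly n R) (s : 'I_r -> mpoly n R),
     [/\ is_sos s0, forall i, is_sos (s i), p = s0 + \sum_i s i * h i,
         deg_le s0 (2 * l) & forall i, deg_le (s i * h i) (2 * l)]].

Definition constraint_violation (x : Rn R n) : R :=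
  `|\big[Num.min/0]_i peval (h i) x|.

(* The distance is an extended real, so that no exponent qualifies when
   [semialg] is empty. *)
Definition is_lojasiewicz_exponent (L : R) : Prop :=
  0 < L /\
  exists2 c : R, 0 < c & forall x, cube R n x ->
    (edist_set semialg x `^ L <= (c * constraint_violation x)%:E)%E.

Definition is_putinar_constant (L g : R) : Prop :=
  1 <= g /\
  forall p, (forall x, semialg x -> 0 < peval p x) ->
  forall l : nat,
    g * (deg p)%:R `^ (7 / 2 * n%:R * L)
      * (max_abs_cube p / inf [set peval p x | x in semialg])
          `^ (5 / 2 * n%:R * L) <= l%:R ->
    truncated_quadratic_module l p.

End System.

(* The infimum is taken in the extended reals: it is +oo if no w is feasible. *)
Definition sos_volume (r : nat) (h : 'I_r -> mpoly n R) (l : nat) : \bar R :=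
  ereal_inf [set integral_cube w | w in
    [set w | [/\ deg_le w l,
                 truncated_quadratic_module h l (w - 1) &
                 truncated_quadratic_module cube_polys l w]]].

Definition majorants (X : set (Rn R n)) (d : nat) : set (mpoly n R) :=
  [set w | deg_le w d /\
           forall x, cube R n x -> (\1_X x : R) <= peval w x].

Definition finite_gibbs (X : set (Rn R n)) (cG : R) : Prop :=
  0 <= cG /\
  exists w : nat -> mpoly n R, forall d,
    [/\ majorants X d (w d),
        forall v, majorants X d v ->
          (integral_cube (w d) <= integral_cube v)%E &
        max_cube (w d) <= cG].

Definition degree_bound (g cG L C eps : R) : R :=
  g * (C / eps) `^ (7 / 2 * n%:R * L)
    * (1 + 2 ^+ n.+1 * (cG / eps)) `^ (5 / 2 * n%:R * L).

Lemma semialg_cube_polys : semialg cube_polys = cube R n.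
Proof.
apply/seteqP; split=> x /= H i; move: (H i);
  rewrite /peval /cube_polys /pX mevalB meval1 rmorphXn /= mevalXU subr_ge0;
  by rewrite -ler_norml -real_normK ?num_real // expr_le1.
Qed.

End Polynomials.

(* Main.v *)
Require Import Defs.
From mathcomp Require Import complex polyrcf.
From mathcomp Require Import all_boot all_order all_algebra.
From mathcomp Require Import all_classical all_reals all_analysis.
From mathcomp Require Import measurable_realfun.
From mathcomp Require mpoly.
From mathcomp Require Import ring lra zify.
Import -(notations) mpoly.
Import Order.TTheory GRing.Theory Num.Theory numFieldNormedType.Exports.
Set Implicit Arguments.
Unset Strict Implicit.
Unset Printing Implicit Defensive.
Local Open Scope classical_set_scope.
Local Open Scope ring_scope.

(** The Putinar constants turn positivity into membership as soon as one has
    polynomials [w >= 1_X] on the cube with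
        integral of [w] <= volume of X + O(1/d),   [deg w <= d].       (A)
    Indeed, for [d] of order [1/eps], the Gibbs minimizer [w_d] has an integral
    below that of the polynomial of (A), and [W = w_d + eps / 2^(n+1)] satisfies
    [W >= eps / 2^(n+1)] on the cube, [W - 1 >= eps / 2^(n+1)] on X, and
    [|W|, |W - 1| <= cG + eps / 2^(n+1)]; so both Positivstellensaetze apply
    with degree at most [C / eps] and ratio [1 + 2^(n+1) cG / eps], while the
    integral exceeds that of [w_d] by [eps / 2] only.

    The work is in (A) ([majorant_rate]).  The only obstruction to (A) is a
    thick boundary, and the boundary of X lies in the zero sets of the [h_j].
    Two facts are combined.

    1. The set of points at distance at most [1/m] from the zero set of a
       polynomial [g] has volume O(1/m) ([zero_near_log_derivative_set] and
       [leb_log_derivative_set]).  If at some point every derivative [g'] of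
       [g], of any order, dominates its own first derivatives,
       [|g'| >= t |d_i g'|] with [t = 4n/m], then [g] varies by at most half of
       its value on the ball of radius [1/m], hence has no zero there.  On the
       complement, some [g'] and [i] satisfy [|g'| < t |d_i g'|].  On a line in
       direction [i] this reads [|p| < t |p'|] for a univariate [p]; as
       [p'/p] is the sum of the [1 / (s - z)] over the complex roots [z], it
       forces [s] to be within [t deg p] of the real part of a root, which is a
       set of length O(t).  Fubini concludes; no topology of algebraic sets is
       involved.

    2. There is a polynomial [E] of degree O(m) comparable with
       [1 / (1 + m^2 s^2)] on [-5, 5] ([lorentzian_kernel]).  The majorant is
           c int_X K(x,y)^2 dy + A int_B K(x,z) dz,  K(x,y) = prod_i E(x_i - y_i),
       where [c] normalizes [K^2] and [B] is the neighbourhood of the boundary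
       from 1.  For [x] in X the first term falls short of 1 by the mass of
       [c K^2] at points [y] outside X.  Between [x] and such a [y] there is a
       zero of some [h_j], around which [B] contains a box of side [2/m]; so
       [K(x,y)] is at most of order [m^n int_B K(x,z) dz], and the second term
       makes up for the loss ([kernel_le_boundary_mass]).  It costs O(|B|),
       that is O(1/m). *)

(** * Large logarithmic derivatives *)

(** The logarithmic derivative of a split monic polynomial is the sum of the
    [1 / (x - z)] over its roots. *)
Lemma log_derivative_bound (F : numFieldType) (rs : seq F) (x a : F) :
  0 <= a -> (forall z, z \in rs -> a <= `|x - z|) ->
  a * `|(\prod_(z <- rs) ('X - z%:P))^`().[x]| <=
  (size rs)%:R * `|(\prod_(z <- rs) ('X - z%:P)).[x]|.
Proof.
move=> a0; elim: rs => [|z rs IH] far.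
  by rewrite big_nil derivC horner0 normr0 mulr0 mul0r.
have az := far z (mem_head _ _).
have {}IH := IH (fun w wr => far w (mem_behead (s := z :: rs) wr)).
rewrite big_cons; set q := (\prod_(_ <- _) _) in IH *.
rewrite derivM derivXsubC !hornerE /=.
apply: le_trans (ler_wpM2l a0 (ler_normD _ _)) _.
rewrite mulrDr [size _]/= -addn1 natrD [leRHS]mulrDl mul1r addrC lerD //; last first.
  by rewrite normrM ler_wpM2r.
by rewrite !normrM mulrCA [leRHS]mulrCA ler_wpM2l.
Qed.

(** Applied to a complex factorization of [p]; the points [r] are the real parts
    of the roots, which are at most as far from a real [s] as the roots are. *)
Lemma large_log_derivative_near_root (R : rcfType) (p : {poly R}) :
  exists2 rs : seq R, (size rs <= (size p).-1)%N &
  forall s t, 0 <= t -> `|p.[s]| < t * `|p^`().[s]| ->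
    exists2 r, r \in rs & `|s - r| <= (size p).-1%:R * t.
Proof.
pose toC := real_complex R.
have [p0|p0] := eqVneq p 0.
  by exists [::] => // s t _; rewrite p0 deriv0 !horner0 normr0 mulr0 ltxx.
have [rs Prs] := closed_field_poly_normal (map_poly toC p : {poly R[i]}).
set c := lead_coef _ in Prs.
have cN0 : c != 0 by rewrite lead_coef_eq0 map_poly_eq0.
have szrs : (size p).-1 = size rs.
  by rewrite -(size_map_poly toC) Prs size_scale // size_prod_XsubC.
exists (map (@complex.Re R) rs); first by rewrite size_map szrs.
move=> s t t0 lt_st.
have [/hasP[r rrs near]|/hasPn far] := boolP (has (fun r =>
    `|s - r| <= (size p).-1%:R * t) (map (@complex.Re R) rs)); first by exists r.
suff : t * `|p^`().[s]| <= `|p.[s]| by rewrite leNgt lt_st.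
have [rs0|rs_gt0] := posnP (size rs).
  have /size1_polyC-> : (size p <= 1)%N by move: szrs; rewrite rs0; case: size => [|[]].
  by rewrite derivC horner0 normr0 mulr0.
pose a : R := (size rs)%:R * t.
have a0 : 0 <= toC a by rewrite ler0c mulr_ge0.
have /(log_derivative_bound a0) : forall z, z \in rs -> toC a <= `|toC s - z|.
  move=> z zrs; apply: le_trans (normc_ge_Re _).
  rewrite lecR raddfB /=.
  have /= := far _ (map_f _ zrs); rewrite -ltNge szrs => /ltW.
  by case: (z).
move=> /(ler_wpM2l (normr_ge0 c)).
rewrite mulrCA [leRHS]mulrCA -!normrM -!hornerZ -derivZ -Prs.
rewrite deriv_map !horner_map.
have nC (u : R) : `|toC u| = toC `|u| by rewrite normc_def /= expr0n addr0 sqrtr_sqr.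
have sizeC : (size rs)%:R = toC (size rs)%:R by rewrite /toC rmorph_nat.
rewrite !nC sizeC /toC -!rmorphM /= lecR -mulrA ler_pM2l // ltr0n //.
Qed.

(** * Lebesgue measure on R^n by recursion *)

Section LebesgueRnRecursion.
Variable R : realType.
Implicit Types (n : nat).
Notation mu := (@lebesgue_measure R).

(** [lebesgue_Rn] bundled as a measure, for the theory of integration to apply. *)
Definition leb n : {sigma_finite_measure set (Rn R n) -> \bar R} :=
  sval (cid (lebesgue_Rn_sigma_finite R n)).

Lemma lebE n : @lebesgue_Rn R n = leb n.
Proof. exact: svalP (cid (lebesgue_Rn_sigma_finite R n)). Qed.

Definition vcons n (p : measurableTypeR R * Rn R n) : Rn R n.+1 :=
  [the Rn R n.+1 of p.1 :: p.2].

Lemma tnth_vcons0 n p : tnth (@vcons n p) ord0 = p.1.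
Proof. by []. Qed.

Lemma tnth_vconsS n p i : tnth (@vcons n p) (lift ord0 i) = tnth p.2 i.
Proof. by rewrite /vcons tnthS. Qed.

Lemma measurable_vcons n : measurable_fun setT (@vcons n).
Proof. exact: (measurable_cons measurable_fst measurable_snd). Qed.

Lemma lebS n (A : set (Rn R n.+1)) :
  leb n.+1 A = (mu \x leb n)%E (@vcons n @^-1` A).
Proof. by rewrite -lebE /= /pushforward lebE. Qed.

Lemma ge0_integral_lebS n (f : Rn R n.+1 -> \bar R) :
  measurable_fun [set: Rn R n.+1] f -> (forall x, 0 <= f x)%E ->
  (\int[leb n.+1]_x f x = \int[mu \x leb n]_p f (vcons p))%E.
Proof.
move=> mf f0; rewrite -lebE /= lebE.
exact: (ge0_integral_pushforward (@measurable_vcons n) (mu \x leb n)%E).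
Qed.

Definition update n (x : Rn R n) (i : 'I_n) (s : R) : Rn R n :=
  [tuple if j == i then s else tnth x j | j < n].

Lemma tnth_update n (x : Rn R n) i s j :
  tnth (update x i s) j = if j == i then s else tnth x j.
Proof. by rewrite tnth_mktuple. Qed.

Definition slab n (a b : 'I_n -> R) : set (Rn R n) :=
  [set x | forall i, a i <= tnth x i <= b i].

Definition box n (a : R) : set (Rn R n) := slab (fun=> - a) (fun=> a).

Lemma measurable_slab n (a b : 'I_n -> R) : measurable (slab a b).
Proof.
rewrite (_ : slab a b = \bigcap_(i in [set: 'I_n])
  ((fun y : Rn R n => tnth y i) @^-1` `[a i, b i])).
  apply: fin_bigcap_measurable => // i _.
  by rewrite -[X in measurable X]setTI; exact: measurable_tnth.
apply/seteqP; split=> y /= H i; last by have := H i Logic.I; rewrite /= in_itv.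
by move=> _ /=; rewrite in_itv /=; exact: H.
Qed.

Lemma measurable_box n a : measurable (@box n a).
Proof. exact: measurable_slab. Qed.

Lemma leb_box n a : 0 <= a -> leb n (box a) = ((2 * a) ^+ n)%:E.
Proof.
move=> a0; rewrite -lebE.
rewrite (@lebesgue_Rn_box R n (fun=> - a) (fun=> a)) => [|_]; last lra.
by rewrite prodr_const card_ord opprK mulr_natl mulr2n.
Qed.

Lemma integral_le_support d (T : measurableType d)
    (nu : {measure set T -> \bar R}) (D : set T) (g : T -> \bar R) (M : R) :
  measurable D -> measurable_fun setT g -> (forall x, 0 <= g x)%E -> 0 <= M ->
  (forall x, ~ D x -> g x = 0)%E -> (forall x, D x -> g x <= M%:E)%E ->
  (\int[nu]_x g x <= M%:E * nu D)%E.
Proof.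
move=> mD mg g0 M0 gout gin; rewrite -integral_cst // [leRHS]integral_mkcond.
apply: ge0_le_integral => //.
  by apply/(measurable_restrictT _ mD); exact: measurable_cst.
move=> x _; rewrite patchE; case: ifPn => [/set_mem/gin //|].
by move=> /negP xD; rewrite gout // => Dx; apply: xD; exact: mem_set.
Qed.

(** Fubini in the direction [i].  The section of [A] is only bounded through a
    measurable cover, so that the measurability of the section itself need not be
    established for every direction. *)
Lemma leb_line_sections n (i : 'I_n) (A : set (Rn R n)) (a c : R) :
  0 <= a -> 0 <= c -> measurable A -> A `<=` box a ->
  (forall x, exists S, [/\ measurable S, [set s | A (update x i s)] `<=` S &
    (mu S <= c%:E)%E]) ->
  (leb n A <= (c * (2 * a) ^+ n.-1)%:E)%E.
Proof.
move=> a0; elim: n i A c => [[] //|n IH] i A c c0 mA Abox cA.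
rewrite lebS; set X := @vcons n @^-1` A.
have mX : measurable X.
  by rewrite -[X in measurable X]setTI; apply: measurable_vcons.
have Abox1 s y : A (vcons (s, y)) -> - a <= s <= a.
  by move=> /Abox /(_ ord0); rewrite tnth_vcons0.
have Abox2 s y : A (vcons (s, y)) -> box a y.
  by move=> /Abox Ay j; move: (Ay (lift ord0 j)); rewrite tnth_vconsS.
case: (unliftP ord0 i) => [j ij|i0].
(* The direction is not the first one: slice by the first coordinate. *)
- have n_gt0 : (0 < n)%N by exact: leq_ltn_trans (ltn_ord j).
  have muI : mu `[- a, a] = (2 * a)%:E.
    rewrite lebesgue_measure_itv /= lte_fin; case: ltrP => [_|a0'].
      by rewrite -EFinD opprK mulr_natl.
    by rewrite (_ : a = 0) ?mulr0 //; lra.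
  have -> : (c * (2 * a) ^+ n = (c * (2 * a) ^+ n.-1) * (2 * a))%R.
    by rewrite -mulrA -exprSr prednK.
  rewrite EFinM -muI; apply: integral_le_support => //.
  + exact: measurable_fun_xsection.
  + by rewrite mulr_ge0 ?exprn_ge0 ?mulr_ge0.
  + move=> s sI /=; rewrite (_ : xsection X s = set0) ?measure0 //.
    apply/seteqP; split=> // y; rewrite /xsection /= inE => /Abox1 sa; apply: sI.
    by rewrite /= in_itv.
  + move=> s _; apply: (IH j) => //.
    * exact: measurable_xsection.
    * by move=> y; rewrite /xsection /= inE => /Abox2.
    * move=> y; have [S [mS AS Sc]] := cA (vcons (s, y)).
      exists S; split=> // t; rewrite /= /xsection /= inE => H; apply: AS => /=.
      rewrite (_ : update _ _ _ = vcons (s, update y j t)) //.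
      apply: eq_from_tnth => k; rewrite tnth_update ij.
      case: (unliftP ord0 k) => [k' ->|->]; last by rewrite !tnth_vcons0.
      by rewrite !tnth_vconsS tnth_update (inj_eq lift_inj).
(* The direction is the first one: integrate it innermost. *)
- have -> : ((mu \x leb n) X = (mu \x^ leb n) X)%E.
    by apply: product_measure_unique => //= *; rewrite product_measure2E.
  rewrite EFinM -leb_box // /=; apply: integral_le_support => //.
  + exact: measurable_box.
  + exact: measurable_fun_ysection.
  + move=> y yI /=; rewrite (_ : ysection X y = set0) ?measure0 //.
    by apply/seteqP; split=> // s; rewrite /ysection /= inE => /Abox2.
  + move=> y _ /=; have [S [mS AS Sc]] := cA (vcons (0, y)).
    apply: le_trans Sc; apply: le_measure; rewrite ?inE //.
      exact: measurable_ysection.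
    move=> t; rewrite /ysection /= inE => H; apply: AS => /=.
    rewrite (_ : update _ _ _ = vcons (t, y)) //.
    apply: eq_from_tnth => k; rewrite tnth_update i0.
    case: (unliftP ord0 k) => [k' ->|->]; last by rewrite tnth_vcons0.
    by rewrite !tnth_vconsS.
Qed.

Lemma measure_bigsetU_seq_le d (T : measurableType d)
    (nu : {measure set T -> \bar R}) (I : eqType) (s : seq I) (f : I -> set T)
    (c : R) :
  (forall i, i \in s -> measurable (f i)) ->
  (forall i, i \in s -> (nu (f i) <= c%:E)%E) ->
  (nu (\big[setU/set0]_(i <- s) f i) <= ((size s)%:R * c)%:E)%E.
Proof.
elim: s => [|i s IH] mf fc; first by rewrite big_nil measure0 mul0r.
rewrite big_cons /= -addn1 natrD mulrDl mul1r addrC EFinD.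
have ms : measurable (\big[setU/set0]_(j <- s) f j).
  rewrite big_seq; apply: bigsetU_measurable => j js.
  by apply: mf; rewrite inE js orbT.
have mi : measurable (f i) by apply: mf; exact: mem_head.
apply: le_trans (measureU2 _ mi ms) _; apply: leeD.
  by apply: fc; exact: mem_head.
by apply: IH => j js; [apply: mf|apply: fc]; rewrite inE js orbT.
Qed.
End LebesgueRnRecursion.

(** * Integrals of products and of Lorentzians *)

Section ProductIntegrals.
Variable R : realType.
Notation mu := (@lebesgue_measure R).

Lemma ge0_integral_prod n (f : 'I_n -> R -> R) (c : 'I_n -> R) :
  (forall i, measurable_fun setT (f i)) -> (forall i s, 0 <= f i s) ->
  (forall i, \int[mu]_s (f i s)%:E = (c i)%:E)%E ->
  (\int[leb R n]_x (\prod_i f i (tnth x i))%:E = (\prod_i c i)%:E)%E.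
Proof.
elim: n f c => [|n IH] f c mf f0 fc.
  rewrite -lebE /= integral_dirac //; last first.
    by apply/measurable_EFinP; apply: measurable_prod => -[].
  by rewrite diracT mul1e !big_ord0.
have mprod k (g : 'I_k -> R -> R) : (forall i, measurable_fun setT (g i)) ->
    measurable_fun [set: Rn R k] (fun x => \prod_i g i (tnth x i)).
  move=> mg; apply: measurable_prod => i _.
  by apply: measurableT_comp (mg i) _; exact: measurable_tnth.
have mF := mprod _ _ mf.
rewrite ge0_integral_lebS; last 2 first.
- exact/measurable_EFinP.
- by move=> x; rewrite lee_fin prodr_ge0.
rewrite fubini_tonelli1 /=; last 2 first.
- by apply/measurable_EFinP; apply: measurableT_comp mF _; exact: measurable_vcons.
- by move=> x; rewrite lee_fin prodr_ge0.
transitivity (\int[mu]_s ((f ord0 s)%:E * (\prod_i c (lift ord0 i))%:E))%E.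
  apply: eq_integral => s _; rewrite /fubini_F /=.
  rewrite (eq_integral (fun y : Rn R n =>
     (f ord0 s)%:E * (\prod_i f (lift ord0 i) (tnth y i))%:E)%E); last first.
    move=> y _; rewrite big_ord_recl -EFinM tnth_vcons0; congr (_ * _)%:E.
    by apply: eq_bigr => i _; rewrite tnth_vconsS.
  rewrite ge0_integralZl //; last 3 first.
  - by apply/measurable_EFinP; exact: (mprod n (fun i => f (lift ord0 i))).
  - by move=> y _; rewrite lee_fin prodr_ge0.
  - by rewrite lee_fin.
  congr (_ * _)%E.
  exact: (IH (fun i => f (lift ord0 i)) (fun i => c (lift ord0 i))).
rewrite ge0_integralZr //; last 3 first.
- by apply/measurable_EFinP; exact: (mf ord0).
- by move=> s _; rewrite lee_fin.
- rewrite lee_fin prodr_ge0 // => i _; rewrite -lee_fin -fc.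
  by apply: integral_ge0 => s _; rewrite lee_fin.
by rewrite fc -EFinM big_ord_recl.
Qed.

Lemma ge0_integral_prod_le n (f : 'I_n -> R -> R) (c : R) :
  (forall i, measurable_fun setT (f i)) -> (forall i s, 0 <= f i s) ->
  (forall i, \int[mu]_s (f i s)%:E <= c%:E)%E ->
  (\int[leb R n]_x (\prod_i f i (tnth x i))%:E <= (c ^+ n)%:E)%E.
Proof.
move=> mf f0 fc.
have If0 i : (0 <= \int[mu]_s (f i s)%:E)%E.
  by apply: integral_ge0 => s _; rewrite lee_fin.
have Ifin i : (\int[mu]_s (f i s)%:E = (fine (\int[mu]_s (f i s)%:E))%:E)%E.
  by rewrite fineK // ge0_fin_numE // (le_lt_trans (fc i)) // ltry.
rewrite (ge0_integral_prod mf f0 Ifin) lee_fin.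
apply: le_trans (_ : \prod_(i < n) c <= _); last by rewrite prodr_const card_ord.
by apply: ler_prod => i _; rewrite fine_ge0 //= -lee_fin -Ifin.
Qed.

Lemma integral_derivative (f F : R -> R) a b : a < b -> continuous f ->
  (forall x : R, is_derive x 1 F (f x)) ->
  (\int[mu]_(x in `[a, b]) (f x)%:E = (F b - F a)%:E)%E.
Proof.
move=> ab cf dF; rewrite EFinB; apply: continuous_FTC2 => //.
- exact: continuous_subspaceT.
- have cF x : {for x, continuous F}.
    by apply/differentiable_continuous/derivable1_diffP; case: (dF x).
  split=> [x _||]; first by case: (dF x).
  + by apply: cvg_at_right_filter; exact: cF.
  + by apply: cvg_at_left_filter; exact: cF.
- by move=> x _; rewrite derive1E; case: (dF x).
Qed.

Lemma integral_poly (P : {poly R}) a b : a < b ->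
  (\int[mu]_(x in `[a, b]) (P^`().[x])%:E = (P.[b] - P.[a])%:E)%E.
Proof.
move=> ab; apply: (integral_derivative (F := horner P)) => //.
exact: continuous_horner.
Qed.

Lemma exists_primitive (p : {poly R}) : exists P : {poly R}, P^`() = p.
Proof.
exists (\poly_(i < (size p).+1) (p`_i.-1 / i%:R)).
apply/polyP => i; rewrite coef_deriv coef_poly ltnS /=.
case: ltnP => [_|/leq_sizeP/(_ _ (leqnn _)) ->]; last by rewrite mul0rn.
by rewrite -[LHS]mulr_natr -mulrA mulVf ?mulr1 // pnatr_eq0.
Qed.

Lemma continuous_lorentzian (m y : R) :
  continuous (fun s : R => (1 + m ^+ 2 * (s - y) ^+ 2)^-1).
Proof.
move=> s; apply: cvgV.
  by rewrite gt_eqF // ltr_pwDl // mulr_ge0 // sqr_ge0.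
have : continuous (horner (1 + (m ^+ 2)%:P * ('X - y%:P) ^+ 2)).
  exact: continuous_horner.
move=> /(_ s); rewrite (_ : horner _ = fun s => 1 + m ^+ 2 * (s - y) ^+ 2) //.
by rewrite funeqE => x; rewrite !hornerE.
Qed.

(** The primitive is [atan (m (s - y)) / m], and [pi <= 4]. *)
Lemma integral_lorentzian_le (m a b y : R) : 0 < m -> a < b ->
  (\int[mu]_(s in `[a, b]) ((1 + m ^+ 2 * (s - y) ^+ 2)^-1)%:E <= (4 / m)%:E)%E.
Proof.
move=> m0 ab; pose f s : R := (1 + m ^+ 2 * (s - y) ^+ 2)^-1.
pose F s : R := m^-1 * atan (m * (s - y)).
have cf : continuous f by exact: continuous_lorentzian.
have dF (s : R) : is_derive s (1 : R) F (f s).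
  have D1 : is_derive s (1 : R) (fun s => m * (s - y)) m.
    have := is_derive_poly (m%:P * ('X - y%:P)) s.
    rewrite (_ : horner _ = fun s => m * (s - y)); last first.
      by rewrite funeqE => x; rewrite !hornerE.
    by rewrite derivM derivC mul0r add0r derivXsubC !hornerE.
  have D2 := is_derive1_comp (g := fun s => m * (s - y))
    (is_derive1_atan (m * (s - y))) D1.
  have := @is_deriveZ _ _ _ _ m^-1 _ _ _ D2.
  rewrite exprMn (_ : m^-1 *: _ = f s) //.
  have N0 : 1 + m ^+ 2 * (s - y) ^+ 2 != 0.
    by rewrite gt_eqF // ltr_pwDl // mulr_ge0 // sqr_ge0.
  rewrite /GRing.scale /= /f; field.
  by rewrite exprMn N0 gt_eqF.
rewrite (integral_derivative ab cf dF) lee_fin -mulrBr mulrC ler_pM2r ?invr_gt0 //.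
have := pihalf_lt2 R.
have := atan_gtNpi2 (m * (a - y)); have := atan_ltpi2 (m * (b - y)).
by move: (atan _) (atan _) (pi / 2) => *; lra.
Qed.
End ProductIntegrals.

(** * Restriction of polynomials to lines *)

Section PolynomialLines.
Variables (R : realType) (n : nat).
Implicit Types (p q g : mpoly n R) (x : Rn R n) (u : 'I_n -> R).

Lemma measurable_peval p : measurable_fun [set: Rn R n] (peval p).
Proof.
rewrite (_ : peval p = fun x : Rn R n =>
  \sum_(m <- msupp p) mcoeff m p * \prod_i tnth x i ^+ m i); last first.
  by apply/funext => x; rewrite /peval mevalE.
apply: measurable_sum => m; apply: measurable_funM => //.
apply: measurable_prod => i _; apply: measurable_funX.
exact: measurable_tnth.
Qed.

Lemma peval_bounded p a :
  exists2 M, 0 <= M & forall x, box a x -> `|peval p x| <= M.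
Proof.
exists (\sum_(m <- msupp p) `|mcoeff m p| * \prod_i `|a| ^+ m i).
  by apply: sumr_ge0 => m _; rewrite mulr_ge0 // prodr_ge0 // => i _; rewrite exprn_ge0.
move=> x ax; rewrite /peval mevalE; apply: le_trans (ler_norm_sum _ _ _) _.
apply: ler_sum => m _; rewrite normrM ler_wpM2l // normr_prod.
apply: ler_prod => i _; rewrite normr_ge0 normrX lerXn2r ?nnegrE //.
have /andP[? ?] := ax i; rewrite ler_norml (le_trans _ (ler_norm a)) // andbT.
by rewrite lerNl (le_trans _ (ler_norm a)) // lerNl.
Qed.

Definition shift x u s : Rn R n := [tuple tnth x i + u i * s | i < n].

Lemma tnth_shift x u s i : tnth (shift x u s) i = tnth x i + u i * s.
Proof. by rewrite tnth_mktuple. Qed.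

Definition line p x u : {poly R} :=
  mmap (@polyC R) (fun i => (tnth x i)%:P + u i *: 'X) p.

Lemma horner_line p x u s : (line p x u).[s] = peval p (shift x u s).
Proof.
rewrite /line /mmap /peval mevalE horner_sum; apply: eq_bigr => m _.
rewrite hornerM hornerC /mmap1 horner_prod; congr (_ * _).
by apply: eq_bigr => i _; rewrite horner_exp tnth_shift !hornerE.
Qed.

Lemma size_line p x u : (size (line p x u) <= msize p)%N.
Proof.
apply: leq_trans (size_sum _ _ _) _; rewrite big_seq; apply/bigmax_leqP_seq => m mp _.
apply: leq_trans (msize_mdeg_lt mp).
rewrite mul_polyC; apply: leq_trans (size_scale_leq _ _) _.
rewrite /mmap1 mdegE; apply: (big_ind2 (fun (q : {poly R}) k => size q <= k.+1)%N).
- by rewrite size_poly1.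
- move=> q1 k1 q2 k2 H1 H2; apply: leq_trans (size_polyMleq _ _) _.
  by rewrite -ltnS; lia.
- move=> i _; apply: leq_trans (size_poly_exp_leq _ _) _.
  rewrite ltnS -[leqRHS]mul1n leq_mul2r; apply/orP; right.
  rewrite -subn1 leq_subLR addn1.
  rewrite (leq_trans (size_polyD _ _)) // geq_max (leq_trans (size_polyC_leq1 _)) //.
  by rewrite (leq_trans (size_scale_leq _ _)) // size_polyX.
Qed.

(** Both sides are derivations along the ring morphism [line], so they need only
    be compared on the variables. *)
Lemma deriv_line p x u :
  (line p x u)^`() = \sum_i u i *: line (mderiv i p) x u.
Proof.
pose D q := \sum_i u i *: line (mderiv i q) x u.
have lineM q1 q2 : line (q1 * q2) x u = line q1 x u * line q2 x u.
  by rewrite /line rmorphM.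
have lineZ c q : line (c *: q) x u = c *: line q x u.
  by rewrite /line mmapZ mul_polyC.
have lineD q1 q2 : line (q1 + q2) x u = line q1 x u + line q2 x u.
  by rewrite /line mmapD.
have DD q1 q2 : D (q1 + q2) = D q1 + D q2.
  rewrite /D -big_split /=; apply: eq_bigr => i _.
  by rewrite mderivD lineD scalerDr.
have DZ c q : D (c *: q) = c *: D q.
  rewrite /D scaler_sumr; apply: eq_bigr => i _.
  by rewrite mderivZ lineZ !scalerA mulrC.
have DM q1 q2 : D (q1 * q2) = D q1 * line q2 x u + line q1 x u * D q2.
  rewrite /D mulr_suml mulr_sumr -big_split /=; apply: eq_bigr => i _.
  by rewrite mderivM lineD !lineM scalerDr scalerAl scalerAr.
have D1 : D 1 = 0.
  rewrite /D big1 // => i _.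
  by rewrite -mpolyC1 mderivC /line mmap0 scaler0.
rewrite -/(D p).
have line1 : line 1 x u = 1 by rewrite /line rmorph1.
elim/mpolyind: p => [|c m p _ _ IH].
  by rewrite -[X in D X](scale0r (0 : mpoly n R)) DZ scale0r /line mmap0 deriv0.
rewrite lineD DD derivD IH; congr (_ + _); rewrite lineZ DZ derivZ; congr (_ *: _).
rewrite mpolyXE_id; apply: (big_ind (fun q => (line q x u)^`() = D q)).
- by rewrite line1 derivC.
- by move=> q1 q2 H1 H2; rewrite lineM DM derivM H1 H2.
- move=> i _; elim: (m i) => [|k IHk]; first by rewrite expr0 line1 derivC.
  rewrite exprS lineM DM derivM IHk; congr (_ * _ + _).
  rewrite /D (bigD1 i) //= big1 ?addr0.
    rewrite mderivX mnm1E eqxx scale1r (_ : mnm_sub _ _ = mnm0) ?mpolyX0 ?line1; last first.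
      by apply/mnmP => j; rewrite mnmBE mnm0E subnn.
    by rewrite /line mmapX mmap1U derivD derivC add0r derivZ derivX.
  move=> j ji; rewrite mderivX mnm1E eq_sym (negPf ji) scale0r /line mmap0 scaler0 //.
Qed.
End PolynomialLines.

(** * Neighbourhoods of zero sets *)

Section ZeroSetNeighbourhood.
Variables (R : realType) (n : nat).
Implicit Types (p q g : mpoly n R) (x y z : Rn R n) (u : 'I_n -> R).
Implicit Types (w : seq 'I_n) (i : 'I_n).
Notation mu := (@lebesgue_measure R).

Lemma msize_mderiv g i : (msize (mderiv i g) <= (msize g).-1)%N.
Proof.
rewrite [leqLHS]msizeE; apply/bigmax_leqP_seq => m.
rewrite mcoeff_msupp mcoeff_mderiv => mg _.
have : mnm_add m (mnm1 i) \in msupp g.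
  by rewrite mcoeff_msupp; apply: contraNneq mg => ->; rewrite mul0rn.
by move=> /msize_mdeg_lt; rewrite mdegD mdeg1 addn1; case: (msize g).
Qed.

Definition mderivs w g : mpoly n R := foldr (@mderiv n R) g w.

Lemma msize_mderivs w g : (msize (mderivs w g) <= msize g - size w)%N.
Proof.
elim: w => [|i w IH] /=; first by rewrite subn0.
by rewrite (leq_trans (msize_mderiv _ _)) // subnS -!subn1 leq_sub2r.
Qed.

Lemma mderivs_eq0 w g : (msize g <= size w)%N -> mderivs w g = 0.
Proof.
move=> gw; apply/eqP; rewrite -msize_poly_eq0 -leqn0.
by rewrite (leq_trans (msize_mderivs _ _)) // leqn0 subn_eq0.
Qed.

Lemma shift0 x u : shift x u 0 = x.
Proof. by apply: eq_from_tnth => i; rewrite tnth_shift mulr0 addr0. Qed.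

(** By induction on the degree: the mean value theorem expresses the variation of
    [g] by its first derivatives at a nearby point, which by induction are at
    most twice their values at [x]. *)
Lemma small_derivatives_small_variation g x u (d : R) : 0 <= d ->
  (forall w i, n%:R * (4 * d) * `|peval (mderivs (i :: w) g) x|
     <= `|peval (mderivs w g) x|) ->
  (forall i, `|u i| <= d) ->
  `|peval g (shift x u 1) - peval g x| <= 2^-1 * `|peval g x|.
Proof.
move=> d0; have [k] := ubnP (msize g); elim: k g u => // k IH g u gk small ud.
have [c c01 Ec] := poly_mvt (line g x u) ltr01.
rewrite !horner_line shift0 subr0 mulr1 deriv_line horner_sum in Ec; rewrite {}Ec.
move: c01; rewrite inE /= => /andP[c0 c1].
apply: le_trans (ler_norm_sum _ _ _) _.
have [->|g0] := eqVneq g 0.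
  rewrite big1 => [|i _]; first by rewrite mulr_ge0.
  by rewrite mderiv0 /line mmap0 scaler0 horner0 normr0.
have term i : n%:R * `|(u i *: line (mderiv i g) x u).[c]| <= 2^-1 * `|peval g x|.
  rewrite hornerZ horner_line normrM.
  have shiftc : shift x u c = shift x (fun i => u i * c) 1.
    by apply: eq_from_tnth => j; rewrite !tnth_shift mulr1.
  have := IH (mderiv i g) (fun i => u i * c).
  rewrite -shiftc => /(_ _ _ _)/wrap[].
  - rewrite (leq_ltn_trans (msize_mderiv _ _)) //.
    by move: gk g0; rewrite -msize_poly_eq0; case: (msize g).
  - by move=> w j; have := small (rcons w i) j; rewrite /mderivs /= !foldr_rcons.
  - move=> j; rewrite normrM (ger0_norm (ltW c0)) (le_trans _ (ud j)) //.
    by rewrite ler_piMr // ltW.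
  set b := peval (mderiv i g) _; set b0 := peval (mderiv i g) x => Hb.
  have {Hb} bb0 : `|b| <= 2 * `|b0|.
    have := ler_normB (b - b0) (- b0); rewrite opprK subrK normrN => H.
    have := normr_ge0 b0; lra.
  have := small [::] i; rewrite /mderivs /= -/b0 => Hi.
  have : n%:R * (`|u i| * `|b|) <= n%:R * (d * (2 * `|b0|)).
    by rewrite ler_wpM2l // ler_pM.
  move=> /le_trans; apply; have := ler0n R n; lra.
have [n0|n_gt0] := posnP n.
  rewrite big1 ?mulr_ge0 // => i; have := ltn_ord i; rewrite {2}n0 ltn0 //.
rewrite -(ler_pM2l (_ : 0 < n%:R)) ?ltr0n // mulr_sumr.
apply: le_trans (ler_sum _ (fun i _ => term i)) _.
by rewrite sumr_const card_ord mulr_natl.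
Qed.

(** The inequality is strict to leave out the points where both sides vanish,
    which may fill a whole line. *)
Definition log_derivative_set g (t a : R) : set (Rn R n) :=
  [set x | box a x /\ exists w i,
    `|peval (mderivs w g) x| < t * `|peval (mderivs (i :: w) g) x|].

(** A point outside of the set would have [g] vary by at most half of its value up
    to [z]; hence [g], and then all its derivatives, would vanish at [x], and [g]
    would be the zero function. *)
Lemma zero_near_log_derivative_set g (d a : R) x z :
  0 < d -> (exists y, peval g y != 0) -> peval g z = 0 ->
  (forall i, `|tnth x i - tnth z i| <= d) -> box a x ->
  log_derivative_set g (n%:R * (4 * d)) a x.
Proof.
move=> d0 [y gy0] gz xz ax; split=> //; apply: contrapT => Nex.
have small w i : n%:R * (4 * d) * `|peval (mderivs (i :: w) g) x|
     <= `|peval (mderivs w g) x|.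
  by rewrite leNgt; apply/negP => lt; apply: Nex; exists w, i.
have gx0 : peval g x = 0.
  have := small_derivatives_small_variation (ltW d0) small
    (u := fun i => tnth z i - tnth x i).
  rewrite (_ : shift _ _ _ = z); last first.
    by apply: eq_from_tnth => i; rewrite tnth_shift mulr1 addrC subrK.
  rewrite gz sub0r normrN => H; apply/eqP; rewrite -normr_le0.
  have {H} : `|peval g x| <= 2^-1 * `|peval g x| by apply: H => i; rewrite distrC.
  by move=> H; have := normr_ge0 (peval g x); lra.
have dx0 w : peval (mderivs w g) x = 0.
  elim: w => [//|i w IH]; apply/eqP; rewrite -normr_le0.
  have := small w i; rewrite IH normr0 pmulr_rle0 // mulr_gt0 ?mulr_gt0 //.
  by rewrite ltr0n (leq_ltn_trans _ (ltn_ord i)).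
(* As all derivatives vanish at x, the variation estimate holds at any scale. *)
pose e := \sum_i `|tnth y i - tnth x i|.
have e0 : 0 <= e by apply: sumr_ge0.
have := @small_derivatives_small_variation g x (fun i => tnth y i - tnth x i) e e0.
rewrite (_ : shift _ _ _ = y); last first.
  by apply: eq_from_tnth => i; rewrite tnth_shift mulr1 addrC subrK.
rewrite gx0 subr0 normr0 mulr0 normr_le0 (negPf gy0) => H.
suff : false by []; apply: H => [w i|i].
  by rewrite !dx0 normr0 mulr0.
by rewrite /e (bigD1 i) //= lerDl sumr_ge0.
Qed.
End ZeroSetNeighbourhood.

Section LogDerivativeSetMeasure.
Variables (R : realType) (n : nat).
Implicit Types (p q g : mpoly n R) (x y z : Rn R n) (u : 'I_n -> R).
Implicit Types (w : seq 'I_n) (i : 'I_n).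
Notation mu := (@lebesgue_measure R).

Lemma log_derivative_set_poly (p : {poly R}) (t : R) : 0 <= t ->
  exists S, [/\ measurable S, [set s | `|p.[s]| < t * `|p^`().[s]|] `<=` S &
    (mu S <= (2 * (size p).-1%:R ^+ 2 * t)%:E)%E].
Proof.
move=> t0; have [rs szrs near] := large_log_derivative_near_root p.
set d := (size p).-1 in szrs near *.
pose I (r : R) := `[r - d%:R * t, r + d%:R * t]%classic.
have mI (r : R) : r \in rs -> measurable (I r) by move=> _; exact: measurable_itv.
exists (\big[setU/set0]_(r <- rs) I r); split.
- by rewrite big_seq; exact: bigsetU_measurable.
- move=> s /= /(near _ _ t0)[r rrs rs_near].
  rewrite -bigcup_seq; exists r => //=.
  by rewrite /I /= in_itv /=; move: rs_near; rewrite ler_distl.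
- have muI (r : R) : r \in rs -> (mu (I r) <= (2 * d%:R * t)%:E)%E.
    move=> _; rewrite lebesgue_measure_itv /= lte_fin; case: ifPn => _.
      by rewrite -EFinD lee_fin; lra.
    by rewrite lee_fin !mulr_ge0.
  apply: le_trans (measure_bigsetU_seq_le (nu := mu) mI muI) _.
  rewrite lee_fin (_ : 2 * d%:R ^+ 2 * t = d%:R * (2 * d%:R * t)); last by ring.
  by rewrite ler_wpM2r ?ler_nat // !mulr_ge0.
Qed.

Lemma leb_log_derivative_set_one g i (t a : R) : 0 <= t -> 0 <= a ->
  let A := [set x : Rn R n | box a x /\ `|peval g x| < t * `|peval (mderiv i g) x|] in
  measurable A /\
  (leb R n A <= (2 * (msize g)%:R ^+ 2 * t * (2 * a) ^+ n.-1)%:E)%E.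
Proof.
move=> t0 a0 A.
have mA : measurable A.
  rewrite (_ : A = box a `&`
    [set x | (`|peval g x|%:E < (t * `|peval (mderiv i g) x|)%:E)%E]); last first.
    by apply/seteqP; split=> x /=; rewrite lte_fin.
  apply: measurable_lte; [exact: measurable_box| |]; apply/measurable_EFinP;
    apply: (measurable_funS measurableT (@subsetT _ _)).
    by apply: measurableT_comp => //; exact: measurable_peval.
  apply: measurable_funM => //.
  by apply: measurableT_comp => //; exact: measurable_peval.
split=> //; apply: (leb_line_sections (i := i)) => //.
- by rewrite !mulr_ge0.
- by move=> x [].
move=> x; pose e j : R := (j == i)%:R.
pose l := line g (update x i 0) e.
have E s : update x i s = shift (update x i 0) e s.
  apply: eq_from_tnth => j; rewrite tnth_shift !tnth_update /e.
  by case: eqP => _; rewrite ?mul1r ?add0r ?mul0r ?addr0.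
have El s : (l^`()).[s] = peval (mderiv i g) (update x i s).
  rewrite deriv_line (bigD1 i) //= big1 ?addr0.
    by rewrite /e eqxx scale1r horner_line -E.
  by move=> j ji; rewrite /e (negPf ji) scale0r.
have [S [mS AS muS]] := log_derivative_set_poly l t0.
exists S; split=> //.
  by move=> s [_ H]; apply: AS; rewrite /= El horner_line -E.
apply: le_trans muS _; rewrite lee_fin ler_wpM2r // ler_wpM2l //.
rewrite lerXn2r ?nnegrE // ler_nat (leq_trans (leq_pred _)) //.
exact: size_line.
Qed.

(** Words at least as long as [msize g] give a zero derivative, so that finitely
    many words matter. *)
Lemma leb_log_derivative_set g (a : R) : 0 <= a ->
  exists2 C : R, 0 <= C & forall t, 0 <= t ->
  measurable (log_derivative_set g t a) /\
  (leb R n (log_derivative_set g t a) <= (C * t)%:E)%E.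
Proof.
move=> a0; pose D := msize g.
pose words := flatten [seq [seq tval s | s <- enum {: k.-tuple 'I_n}] | k <- iota 0 D].
pose s := [seq (w, i) | w <- words, i <- enum 'I_n].
exists ((size s)%:R * (2 * D%:R ^+ 2 * (2 * a) ^+ n.-1)).
  by rewrite !mulr_ge0 // exprn_ge0 // mulr_ge0.
move=> t t0; pose F (wi : seq 'I_n * 'I_n) := [set x : Rn R n | box a x /\
  `|peval (mderivs wi.1 g) x| < t * `|peval (mderiv wi.2 (mderivs wi.1 g)) x|].
have F_OK wi : measurable (F wi) /\
    (leb R n (F wi) <= (2 * D%:R ^+ 2 * (2 * a) ^+ n.-1 * t)%:E)%E.
  have [mF leF] := leb_log_derivative_set_one (mderivs wi.1 g) wi.2 t0 a0.
  split=> //; apply: le_trans leF _.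
  rewrite lee_fin mulrAC ler_wpM2r // ler_wpM2r ?exprn_ge0 ?mulr_ge0 //.
  rewrite ler_wpM2l // lerXn2r ?nnegrE // ler_nat.
  by rewrite (leq_trans (msize_mderivs _ _)) // leq_subr.
have -> : log_derivative_set g t a = \big[setU/set0]_(wi <- s) F wi.
  rewrite -bigcup_seq; apply/seteqP; split=> x.
    move=> [ax [w [i lt]]]; exists (w, i) => //=.
    rewrite allpairs_f ?mem_enum //.
    have wD : (size w < D)%N.
      rewrite ltnNge; apply/negP => Dw; move: lt.
      by rewrite /= mderivs_eq0 // mderiv0 /peval meval0 normr0 mulr0 ltxx.
    apply/flattenP; exists [seq tval s | s <- enum {: (size w).-tuple 'I_n}].
      by apply/mapP; exists (size w); rewrite ?mem_iota.
    by apply/mapP; exists (in_tuple w); rewrite ?mem_enum.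
  by move=> [[w i] _ [ax lt]]; split=> //; exists w, i.
split; first by apply: bigsetU_measurable => wi _; have [] := F_OK wi.
apply: le_trans (measure_bigsetU_seq_le (c := 2 * D%:R ^+ 2 * (2 * a) ^+ n.-1 * t) _ _) _.
- by move=> wi _; have [] := F_OK wi.
- by move=> wi _; have [] := F_OK wi.
- by rewrite mulrA.
Qed.
End LogDerivativeSetMeasure.

(** * A polynomial kernel of Lorentzian shape *)

Section LorentzianKernel.
Variable R : realFieldType.

(** The Chebyshev polynomials [T_k] and [U_(k-1)], that is
    [(cos (k a), sin (k a) / sin a)] at [cos a], by the addition formulas. *)
Fixpoint chebyshev (k : nat) : {poly R} * {poly R} :=
  if k is k'.+1 then
    let TU := chebyshev k' in
    ('X * TU.1 + ('X ^+ 2 - 1) * TU.2, TU.1 + 'X * TU.2)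
  else (1, 0).

Lemma size_chebyshev k :
  (size (chebyshev k).1 <= k.+1)%N /\ (size (chebyshev k).2 <= k)%N.
Proof.
elim: k => [|k [IH1 IH2]] /=; first by rewrite size_poly1 size_poly0.
have sX2 : size ('X ^+ 2 - 1 : {poly R}) = 3 by rewrite size_XnsubC.
have sXM (p : {poly R}) l : (size p <= l)%N -> (size ('X * p)%R <= l.+1)%N.
  by move=> pl; rewrite (leq_trans (size_polyMleq _ _)) // size_polyX.
split; rewrite (leq_trans (size_polyD _ _)) // geq_max.
  by rewrite sXM //= (leq_trans (size_polyMleq _ _)) // sX2.
by rewrite sXM // andbT.
Qed.

Lemma chebyshev_pell k x :
  (chebyshev k).1.[x] ^+ 2 + (1 - x ^+ 2) * (chebyshev k).2.[x] ^+ 2 = 1.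
Proof.
elim: k => [|k IH] /=.
  by rewrite hornerC horner0 expr1n expr0n mulr0 addr0.
by rewrite !(hornerD, hornerN, hornerM, hornerXn, hornerX, hornerC) -[RHS]IH; ring.
Qed.

Lemma chebyshev_le1 k x : `|x| <= 1 -> `|(chebyshev k).1.[x]| <= 1.
Proof.
move=> x1; rewrite -[_ <= 1](@ler_pXn2r _ 2) ?nnegrE // expr1n.
rewrite real_normK ?num_real // -(chebyshev_pell k x) lerDl mulr_ge0 ?sqr_ge0 //.
by rewrite subr_ge0 -real_normK ?num_real // expr_le1.
Qed.

(** [T_k] exceeds 1 by a constant already at distance [1 / k^2] from [-1, 1]; this
    quadratic gain is what makes a kernel of degree O(m) resolve the scale [1/m]. *)
Lemma chebyshev_growth k e : 0 <= e ->
  1 + k%:R ^+ 2 * e <= (chebyshev k).1.[1 + e] /\ k%:R <= (chebyshev k).2.[1 + e].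
Proof.
move=> e0; elim: k => [|k [IH1 IH2]] /=.
  by rewrite !hornerE expr0n mul0r addr0.
rewrite !(hornerD, hornerN, hornerM, hornerXn, hornerX, hornerC) -natr1; move: IH1 IH2.
set T := (chebyshev k).1.[_]; set U := (chebyshev k).2.[_] => IH1 IH2.
have k0 : (0 : R) <= k%:R by [].
split; nra.
Qed.

(** Divide [1 - q(w) / q(- m^-2)] by its factor [1 + m^2 w], and put [w = s^2]: the
    quotient is comparable with [1 / (1 + m^2 s^2)] where [|q(w)| <= 1], if [q(- m^-2) >= 3].
    A rescaled Chebyshev polynomial [q] has these properties for [0 <= w <= 25]. *)
Lemma lorentzian_kernel (m : nat) : (0 < m)%N -> exists E : {poly R},
  (size E <= (10 * m).+1)%N /\
  forall s, `|s| <= 5 -> 2^-1 <= E.[s] * (1 + m%:R ^+ 2 * s ^+ 2) <= 2.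
Proof.
move=> m0; pose N := (5 * m)%N; pose a : R := (m%:R ^+ 2)^-1.
have mR : (0 : R) < m%:R by rewrite ltr0n.
have a0 : 0 < a by rewrite invr_gt0 exprn_gt0.
have ma : m%:R ^+ 2 * a = 1 by rewrite mulfV // gt_eqF // exprn_gt0.
clearbody a; pose q := (chebyshev N).1 \Po (1 - (2 / 25) *: 'X).
have qE s : q.[s] = (chebyshev N).1.[1 - 2 / 25 * s].
  by rewrite horner_comp !hornerE.
(* [N = 5 m] is chosen so that [N^2 (2 / 25) m^-2 = 2]. *)
have qa : 3 <= q.[- a].
  rewrite qE mulrN opprK.
  have [|+ _] := @chebyshev_growth N (2 / 25 * a); first by rewrite mulr_ge0 // ltW.
  apply: le_trans; rewrite /N natrM exprMn.
  have -> : 5%:R ^+ 2 * m%:R ^+ 2 * (2 / 25 * a) = 2 * (m%:R ^+ 2 * a) by field.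
  by rewrite ma; lra.
have qa0 : q.[- a] != 0 by rewrite gt_eqF // (lt_le_trans _ qa).
pose p := 1 - (q.[- a])^-1 *: q.
have : root p (- a) by rewrite /root !hornerE mulVf // subrr.
move=> /factor_theorem[r pr].
have sq : (size q <= N.+1)%N.
  apply: leq_trans (size_comp_poly_leq _ _) _; rewrite ltnS.
  have [sT _] := size_chebyshev N.
  have s2 : ((size (1 - (2 / 25) *: 'X : {poly R})%R).-1 <= 1)%N.
    rewrite -subn1 leq_subLR addn1 (leq_trans (size_polyD _ _)) // geq_max size_poly1 /=.
    by rewrite size_polyN (leq_trans (size_scale_leq _ _)) // size_polyX.
  have sT1 : ((size (chebyshev N).1).-1 <= N)%N by rewrite -subn1 leq_subLR add1n.
  by rewrite (leq_trans (leq_mul sT1 s2)) // muln1.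
have sp : (size p <= N.+1)%N.
  rewrite (leq_trans (size_polyD _ _)) // geq_max size_poly1 /= size_polyN.
  by rewrite (leq_trans (size_scale_leq _ _)).
have sr : (size r <= N.+1)%N.
  apply: leq_trans sp; rewrite pr; have [->|r0] := eqVneq r 0; first by rewrite size_poly0.
  by rewrite size_Mmonic ?monicXsubC // size_XsubC addn2.
exists ((a *: r) \Po 'X ^+ 2); split.
  apply: leq_trans (size_comp_poly_leq _ _) _; rewrite ltnS size_polyXn /=.
  rewrite -[10%N]/(2 * 5)%N -mulnA mulnC leq_mul2l /= -subn1 leq_subLR add1n.
  by rewrite (leq_trans (size_scale_leq _ _)).
move=> s s5; rewrite horner_comp hornerXn hornerZ.
have -> : a * r.[s ^+ 2] * (1 + m%:R ^+ 2 * s ^+ 2) = p.[s ^+ 2].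
  rewrite pr hornerM hornerXsubC opprK.
  rewrite (_ : _ * _ * _ = r.[s ^+ 2] * (m%:R ^+ 2 * a * s ^+ 2 + a)); last by ring.
  by rewrite ma mul1r.
have s25 : 0 <= s ^+ 2 <= 25.
  rewrite sqr_ge0 /= -real_normK ?num_real //.
  by have := normr_ge0 s; nra.
have : `|q.[s ^+ 2]| <= 1.
  by rewrite qE; apply: chebyshev_le1; rewrite ler_norml; lra.
rewrite /p !hornerE => qs.
have : `|(q.[- a])^-1 * q.[s ^+ 2]| <= 3^-1.
  rewrite normrM normfV (gtr0_norm (lt_le_trans _ qa)) //.
  rewrite -[3^-1]mulr1 ler_pM // ?invr_ge0 ?(le_trans _ qa) //.
  by rewrite lef_pV2 // posrE // (lt_le_trans _ qa).
by rewrite ler_norml; move: (_^-1 * _) => z; lra.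
Qed.
End LorentzianKernel.

(** * Integrating out a variable of a polynomial kernel *)

Section SeparableKernels.
Variables (R : realType) (n : nat).
Implicit Types (p q v : mpoly n R) (x y : Rn R n) (D : set (Rn R n)).
Implicit Types (F G : Rn R n -> Rn R n -> R).

(** Polynomials in [(x, y)] of degree at most [d] in [x], written so that
    integrating out one of the two variables is a finite linear combination. *)
Definition separable d F := exists s : seq (mpoly n R * mpoly n R),
  (forall ab, ab \in s -> (msize ab.1 <= d.+1)%N) /\
  forall x y, F x y = \sum_(ab <- s) peval ab.1 x * peval ab.2 y.

Lemma eq_separable d F G : separable d F -> (forall x y, F x y = G x y) ->
  separable d G.
Proof. by move=> [s [sd FE]] FG; exists s; split=> // x y; rewrite -FG FE. Qed.

Lemma separable_le d d' F : (d <= d')%N -> separable d F -> separable d' F.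
Proof.
move=> dd' [s [sd FE]]; exists s; split=> // ab /sd abd.
by rewrite (leq_trans abd).
Qed.

Lemma separable_cst c : separable 0 (fun _ _ => c).
Proof.
exists [:: (mpolyC n c, 1)]; split=> [ab|x y].
  by rewrite inE => /eqP->; rewrite msizeC leq_b1.
by rewrite big_seq1 /peval /= mevalC meval1 mulr1.
Qed.

Lemma separableD d F G : separable d F -> separable d G ->
  separable d (fun x y => F x y + G x y).
Proof.
move=> [s [sd FE]] [t [td GE]]; exists (s ++ t); split=> [ab|x y].
  by rewrite mem_cat => /orP[/sd|/td].
by rewrite big_cat /= FE GE.
Qed.

Lemma separableM d e F G : separable d F -> separable e G ->
  separable (d + e) (fun x y => F x y * G x y).
Proof.
move=> [s [sd FE]] [t [te GE]].
exists [seq (ab.1 * cd.1, ab.2 * cd.2) | ab <- s, cd <- t]; split=> [abcd|x y].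
  move=> /allpairsP[[ab cd] /= [/sd abd /te cde ->]] /=.
  have [->|p0] := eqVneq ab.1 0; first by rewrite mul0r msize0.
  have [->|q0] := eqVneq cd.1 0; first by rewrite mulr0 msize0.
  by rewrite msizeM // -subn1 leq_subLR add1n -addnS -addSn leq_add.
rewrite big_allpairs_dep FE GE mulr_suml; apply: eq_bigr => ab _.
rewrite mulr_sumr; apply: eq_bigr => cd _.
by rewrite /peval !mevalM mulrACA.
Qed.

Lemma separable_exp d F k : separable d F ->
  separable (d * k) (fun x y => F x y ^+ k).
Proof.
move=> sF; elim: k => [|k IH]; first by rewrite muln0; exact: separable_cst.
by rewrite mulnS; apply: eq_separable (separableM sF IH) _ => x y; rewrite exprS.
Qed.

Lemma separable_sum d (I : Type) (r : seq I) (F : I -> Rn R n -> Rn R n -> R) :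
  (forall i, separable d (F i)) ->
  separable d (fun x y => \sum_(i <- r) F i x y).
Proof.
move=> sF; elim: r => [|i r IH].
  apply: (@eq_separable d (fun _ _ => 0)) => [|x y]; last by rewrite big_nil.
  by apply: (@separable_le 0); [exact: leq0n|exact: separable_cst].
by apply: eq_separable (separableD (sF i) IH) _ => x y; rewrite big_cons.
Qed.

Lemma separable_diff (E : {poly R}) k (i : 'I_n) : (size E <= k.+1)%N ->
  separable k (fun x y => E.[tnth x i - tnth y i]).
Proof.
move=> sE.
have sz : separable 1 (fun x y => tnth x i - tnth y i).
  exists [:: (pX R i, 1); (1, - pX R i)]; split=> [ab|x y].
    by rewrite !inE => /orP[] /eqP-> /=; rewrite ?msizeX ?mdeg1 ?msize1.
  rewrite !big_cons big_nil /peval /= !meval1 mevalN /pX !mevalXU.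
  by rewrite mulr1 mul1r addr0.
apply: eq_separable (@separable_sum k _ (index_enum 'I_(size E))
   (fun j x y => E`_j * (tnth x i - tnth y i) ^+ j) _) _ => [j|x y].
  apply: (@separable_le (0 + 1 * j)).
    by rewrite add0n mul1n -ltnS (leq_trans (ltn_ord j)).
  by apply: separableM (separable_cst _) _; exact: separable_exp.
by rewrite horner_coef.
Qed.

Lemma separable_prod d (F : 'I_n -> Rn R n -> Rn R n -> R) :
  (forall i, separable d (F i)) ->
  separable (n * d) (fun x y => \prod_i F i x y).
Proof.
move=> sF; have H (r : seq 'I_n) : separable (size r * d) (fun x y => \prod_(i <- r) F i x y).
  elim: r => [|i r IH].
    apply: (@eq_separable 0 (fun _ _ => 1)) => [|x y]; last by rewrite big_nil.
    exact: separable_cst.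
  by apply: eq_separable (separableM (sF i) IH) _ => x y; rewrite big_cons.
by have := H (index_enum 'I_n); rewrite /index_enum -enumT size_enum_ord.
Qed.

Definition polyint D p : R := \int[leb R n]_(x in D) peval p x.

Section BoundedDomain.
Variables (D : set (Rn R n)) (a : R).
Hypotheses (mD : measurable D) (Da : D `<=` box a).

Lemma leb_bounded_fin : (leb R n D < +oo)%E.
Proof.
apply: (@le_lt_trans _ _ (leb R n (box `|a|))); last by rewrite leb_box // ltry.
apply: le_measure; rewrite ?inE //; first exact: measurable_box.
move=> x /Da ax i; have /andP[? ?] := ax i.
rewrite (le_trans _ (ler_norm a)) // andbT.
by rewrite lerNl (le_trans _ (ler_norm a)) // lerNl.
Qed.

Lemma integrable_peval p : (leb R n).-integrable D (fun x => (peval p x)%:E).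
Proof.
apply: measurable_bounded_integrable => //; first exact: leb_bounded_fin.
  by apply: measurable_funS (measurable_peval p) => //.
have [M M0 pM] := peval_bounded p a.
exists M; split; first by rewrite num_real.
by move=> M' MM' x Dx /=; rewrite (le_trans (pM _ (Da Dx))) // ltW.
Qed.

Lemma polyintE p : (\int[leb R n]_(x in D) (peval p x)%:E = (polyint D p)%:E)%E.
Proof.
by rewrite /polyint /Rintegral fineK //; apply: integrable_fin_num (integrable_peval p).
Qed.

Lemma polyintD p q : polyint D (p + q) = polyint D p + polyint D q.
Proof.
rewrite /polyint -RintegralD //; [|exact: integrable_peval..].
by apply: eq_Rintegral => x _; rewrite /peval mevalD.
Qed.

Lemma polyintZ c p : polyint D (c *: p) = c * polyint D p.
Proof.
rewrite /polyint -RintegralZl //; last exact: integrable_peval.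
by apply: eq_Rintegral => x _; rewrite /peval mevalZ.
Qed.

Lemma polyint_sum (I : Type) (r : seq I) (c : I -> R) (p : I -> mpoly n R) :
  polyint D (\sum_(i <- r) c i *: p i) = \sum_(i <- r) c i * polyint D (p i).
Proof.
elim: r => [|i r IH]; first by rewrite !big_nil -(scale0r 0) polyintZ mul0r.
by rewrite !big_cons polyintD polyintZ IH.
Qed.

End BoundedDomain.

Lemma peval_sum (I : Type) (r : seq I) (c : I -> R) (p : I -> mpoly n R) x :
  peval (\sum_(i <- r) c i *: p i) x = \sum_(i <- r) c i * peval (p i) x.
Proof.
rewrite /peval; elim: r => [|i r IH]; first by rewrite !big_nil meval0.
by rewrite !big_cons mevalD mevalZ IH.
Qed.

(** Both orders of integration give the same finite sum of products of integrals,
    so the bound on the inner integral over [x] bounds the integral of [v]. *)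
Lemma separable_integral d F D a M : separable d F -> measurable D ->
  D `<=` box a ->
  (forall y, D y -> (\int[leb R n]_(x in cube R n) (F x y)%:E <= M%:E)%E) ->
  exists v, [/\ deg_le v d,
    forall x, (\int[leb R n]_(y in D) (F x y)%:E = (peval v x)%:E)%E &
    (integral_cube v <= M%:E * leb R n D)%E].
Proof.
move=> [s [sd FE]] mD Da FM.
have mK : measurable (cube R n) by exact: measurable_box.
have KK : cube R n `<=` box 1 by [].
exists (\sum_(ab <- s) polyint D ab.2 *: ab.1); split.
- rewrite /deg_le (leq_trans (msize_sum _ _ _)) //.
  apply/bigmax_leqP_seq => ab abs _.
  by rewrite (leq_trans (msizeZ_le _ _)) // sd.
- move=> x; rewrite peval_sum.
  rewrite (eq_integral (fun y : Rn R n =>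
    (peval (\sum_(ab <- s) peval ab.1 x *: ab.2) y)%:E)); last first.
    by move=> y _; rewrite FE peval_sum.
  rewrite (polyintE mD Da) (polyint_sum mD Da).
  by congr _%:E; apply: eq_bigr => ab _; rewrite mulrC.
- rewrite /integral_cube lebE (polyintE mK KK) (polyint_sum mK KK).
  rewrite (eq_bigr (fun ab => polyint (cube R n) ab.1 * polyint D ab.2)); last first.
    by move=> ab _; rewrite mulrC.
  rewrite -(polyint_sum mD Da) -(polyintE mD Da) -integral_cst //.
  apply: le_integral => //.
  + exact: (integrable_peval mD Da).
  + apply/integrableP; split; first exact: measurable_cst.
    rewrite integral_cst //= lte_mul_pinfty // ?ge0_fin_numE //.
    exact: leb_bounded_fin Da.
  + move=> y Dy; rewrite (le_trans _ (FM y (set_mem Dy))) //.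
    rewrite (eq_integral (fun x : Rn R n =>
      (peval (\sum_(ab <- s) peval ab.2 y *: ab.1) x)%:E)); last first.
      by move=> x _; rewrite FE peval_sum; congr _%:E; apply: eq_bigr => ab _; rewrite mulrC.
    rewrite (polyintE mK KK) (polyint_sum mK KK) peval_sum lee_fin.
    by rewrite le_eqVlt; apply/orP; left; apply/eqP; apply: eq_bigr => ab _; rewrite mulrC.
Qed.
End SeparableKernels.

(** * Estimates on the kernel *)

Section BoxIntegrals.
Variables (R : realType).
Notation mu := (@lebesgue_measure R).

Lemma integral_slab_restrict n (a b : 'I_n -> R) (g : 'I_n -> {poly R}) :
  (\int[leb R n]_(x in slab a b) (\prod_i (g i).[tnth x i])%:E =
   \int[leb R n]_x (\prod_i ((horner (g i)) \_ `[a i, b i]) (tnth x i))%:E)%E.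
Proof.
rewrite integral_mkcond; apply: eq_integral => x _.
rewrite patchE; case: ifPn => [/set_mem xab|/negP xab].
  congr _%:E; apply: eq_bigr => i _.
  by rewrite patchE mem_set //= in_itv /=; exact: xab.
have [i xi] : exists i, ~~ (a i <= tnth x i <= b i).
  apply/existsP; rewrite -negb_forall; apply/negP => /forallP xab'.
  by apply: xab; exact: mem_set.
congr _%:E; rewrite (bigD1 i) //= patchE memNset ?mul0r //=.
by rewrite in_itv /=; exact/negP.
Qed.

Section SlabProduct.
Variables (n : nat) (a b : 'I_n -> R) (g : 'I_n -> {poly R}).
Hypothesis g0 : forall i s, a i <= s <= b i -> 0 <= (g i).[s].
Let f i := (horner (g i)) \_ `[a i, b i].

Let mf i : measurable_fun setT (f i).
Proof.
apply/(measurable_restrictT _ (measurable_itv _)).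
exact: measurable_poly.
Qed.

Let f0 i s : 0 <= f i s.
Proof.
by rewrite /f patchE; case: ifPn => // /set_mem /=; rewrite in_itv /=; exact: g0.
Qed.

Let fg i : (\int[mu]_s (f i s)%:E =
  \int[mu]_(s in `[a i, b i]) ((g i).[s])%:E)%E.
Proof. by rewrite [RHS]integral_mkcond restrict_EFin. Qed.

Lemma integral_slab_prod (c : R) :
  (forall i, \int[mu]_(s in `[a i, b i]) ((g i).[s])%:E = c%:E)%E ->
  (\int[leb R n]_(x in slab a b) (\prod_i (g i).[tnth x i])%:E = (c ^+ n)%:E)%E.
Proof.
move=> gc; rewrite integral_slab_restrict (@ge0_integral_prod _ n f (fun=> c) mf f0).
  by rewrite prodr_const card_ord.
by move=> i; rewrite fg gc.
Qed.

Lemma integral_slab_prod_le (c : R) :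
  (forall i, \int[mu]_(s in `[a i, b i]) ((g i).[s])%:E <= c%:E)%E ->
  (\int[leb R n]_(x in slab a b) (\prod_i (g i).[tnth x i])%:E <= (c ^+ n)%:E)%E.
Proof.
move=> gc; rewrite integral_slab_restrict; apply: (@ge0_integral_prod_le _ n f c mf f0) => i.
by rewrite fg gc.
Qed.
End SlabProduct.
End BoxIntegrals.

Section KernelEstimates.
Variables (R : realType) (m : nat) (E : {poly R}).
Notation mu := (@lebesgue_measure R).
Hypothesis m0 : (0 < m)%N.
Hypothesis EL : forall s : R, `|s| <= 5 -> 2^-1 <= E.[s] * (1 + m%:R ^+ 2 * s ^+ 2) <= 2.

Let mR : (0 : R) < m%:R. Proof. by rewrite ltr0n. Qed.

Let L s : R := 1 + m%:R ^+ 2 * s ^+ 2.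

Let L1 (s : R) : 1 <= L s.
Proof. by rewrite lerDl mulr_ge0 ?sqr_ge0. Qed.

Let L0 (s : R) : 0 < L s. Proof. exact: lt_le_trans (L1 s). Qed.

Lemma kernel_le (s : R) : `|s| <= 5 -> E.[s] <= 2 * (L s)^-1.
Proof. by move=> /EL/andP[_ +]; rewrite -/(L s) ler_pdivlMr. Qed.

Lemma kernel_ge (s : R) : `|s| <= 5 -> 2^-1 * (L s)^-1 <= E.[s].
Proof. by move=> /EL/andP[+ _]; rewrite -/(L s) ler_pdivrMr. Qed.

Lemma kernel_gt0 (s : R) : `|s| <= 5 -> 0 < E.[s].
Proof. by move=> /kernel_ge; apply: lt_le_trans; rewrite mulr_gt0 ?invr_gt0. Qed.

(** [1 + m^2 (|s| + 1/m)^2 <= 3 (1 + m^2 s^2)], and the two-sided bound on [E] loses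
    a factor 4. *)
Lemma kernel_compare (s t : R) : `|s| <= 5 -> `|t| <= 5 -> `|t| <= `|s| + m%:R^-1 ->
  E.[s] <= 12 * E.[t].
Proof.
move=> s5 t5 ts; apply: le_trans (kernel_le s5) _.
apply: le_trans (_ : 12 * (2^-1 * (L t)^-1) <= _); last by rewrite ler_wpM2l ?kernel_ge.
suff : L t <= 3 * L s.
  move=> H; have : 1 / L s <= 3 / L t.
    by rewrite ler_pdivrMr // mulrAC ler_pdivlMr // mul1r.
  by rewrite mul1r; lra.
have mv : m%:R * m%:R^-1 = 1 :> R by rewrite mulfV // gt_eqF.
have : (m%:R * `|t|) ^+ 2 <= (m%:R * `|s| + 1) ^+ 2.
  rewrite lerXn2r ?nnegrE ?addr_ge0 ?mulr_ge0 // -[X in _ + X]mv -mulrDr.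
  by rewrite ler_wpM2l.
rewrite !exprMn sqrrD !exprMn !real_normK ?num_real // expr1n mulr1 /L.
have := sqr_ge0 (m%:R * `|s| - 1); rewrite sqrrB exprMn real_normK ?num_real //.
by rewrite expr1n mulr1; have := L1 s; rewrite /L; lra.
Qed.

(** The two alternatives for [g] serve to integrate [E (x - y)] in either variable;
    the bound is the same, as the Lorentzian is even. *)
Lemma integral_kernel_le (g : {poly R}) a b y : a < b ->
  (forall s, a <= s <= b -> `|s - y| <= 5) ->
  (forall s, a <= s <= b -> g.[s] = E.[s - y] \/ g.[s] = E.[y - s]) ->
  (\int[mu]_(s in `[a, b]) (g.[s])%:E <= (8 / m%:R)%:E)%E.
Proof.
move=> ab y5 gE.
have g2 s : a <= s <= b -> 0 <= g.[s] <= 2 * (L (s - y))^-1.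
  move=> sab; have s5 := y5 _ sab; have s5' : `|y - s| <= 5 by rewrite distrC.
  have LE : L (y - s) = L (s - y) by rewrite /L -[y - s]opprB sqrrN.
  by case: (gE _ sab) => ->; rewrite ltW ?kernel_gt0 //= ?kernel_le // -LE kernel_le.
have mL : measurable_fun `[a, b] (fun s => (L (s - y))^-1).
  apply: measurable_funS (continuous_measurable_fun _) => //.
  exact: continuous_lorentzian.
apply: le_trans (_ : \int[mu]_(s in `[a, b]) (2 * (L (s - y))^-1)%:E <= _)%E.
  apply: ge0_le_integral => //.
  - by move=> s /=; rewrite in_itv /= lee_fin => /g2/andP[].
  - by apply/measurable_EFinP; exact: measurable_poly.
  - by apply/measurable_EFinP; exact: measurable_funM.
  - by move=> s /=; rewrite in_itv /= lee_fin => /g2/andP[].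
under eq_integral do rewrite EFinM.
rewrite ge0_integralZl //.
- apply: le_trans (lee_wpmul2l _ (integral_lorentzian_le y mR ab)) _ => //.
  by rewrite -EFinM lee_fin; lra.
- exact/measurable_EFinP.
- by move=> s _; rewrite lee_fin invr_ge0 ltW.
Qed.

(** [N] is the integral of [E^2] over [-2, 2].  An interval of length 2 shifted by
    at most 1 stays inside, whence the last bound; on [-1/m, 1/m] the kernel is
    at least [1/4], whence the first. *)
Lemma kernel_square_mass : exists N : R, [/\ (8 * m%:R)^-1 <= N,
  forall x : R, (\int[mu]_(s in `[(x - 2)%R, (x + 2)%R])
    ((E ^+ 2 \Po (x%:P - 'X)).[s])%:E = N%:E)%E &
  forall y : R, `|y| <= 1 -> (\int[mu]_(s in `[(- 1)%R, 1%R])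
    ((E ^+ 2 \Po ('X - y%:P)).[s])%:E <= N%:E)%E].
Proof.
have [P PE] := exists_primitive (E ^+ 2).
have Pmono s t : s <= t -> P.[s] <= P.[t].
  rewrite le_eqVlt => /predU1P[->//|st].
  have [c +] := poly_mvt P st; rewrite in_itv /= => /andP[sc ct] E1.
  rewrite -subr_ge0 E1 mulr_ge0 //; last by rewrite subr_ge0 ltW.
  by rewrite PE horner_exp sqr_ge0.
pose v : R := m%:R^-1.
have v0 : 0 < v by rewrite invr_gt0.
have v1 : v <= 1 by rewrite invf_le1 // ler1n.
exists (P.[2] - P.[-2]); split.
- apply: le_trans (_ : P.[v] - P.[- v] <= _); last first.
    by apply: lerB; apply: Pmono; lra.
  have vv : - v < v by lra.
  have [c +] := poly_mvt P vv.
  rewrite in_itv /= => /andP[sc ct] ->; rewrite PE horner_exp.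
  have cv : `|c| <= v by rewrite ler_norml; lra.
  have Ec : 4^-1 <= E.[c].
    apply: le_trans (kernel_ge _); last by rewrite (le_trans cv) // (le_trans v1) ?ler1n.
    have : L c <= 2.
      rewrite /L -exprMn -real_normK ?num_real // normrM.
      have : `|m%:R| * `|c| <= 1.
        rewrite ger0_norm // -[leRHS](mulfV (lt0r_neq0 mR)); exact: ler_wpM2l.
      move=> mc; suff : (`|m%:R| * `|c|) ^+ 2 <= 1 by lra.
      by rewrite expr_le1 // mulr_ge0.
    move=> L2; have : 2^-1 <= (L c)^-1 by rewrite lef_pV2 ?posrE.
    lra.
  have : 4^-1 ^+ 2 <= E.[c] ^+ 2 by rewrite lerXn2r ?nnegrE //; lra.
  by rewrite invfM -/v; nra.
- move=> x; have := @integral_poly R (- (P \Po (x%:P - 'X))) (x - 2) (x + 2).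
  rewrite derivN deriv_comp PE derivB derivC derivX sub0r mulrN1 opprK => ->; last lra.
  rewrite !hornerN !horner_comp !hornerD !hornerN !hornerX !hornerC.
  by congr _%:E; rewrite [LHS]addrC opprK; congr (_.[_] - _.[_]); ring.
- move=> y /[!ler_norml] y1.
  have := @integral_poly R (P \Po ('X - y%:P)) (-1) 1.
  rewrite deriv_comp PE derivB derivC derivX subr0 mulr1 => ->; last lra.
  rewrite lee_fin !horner_comp !hornerD !hornerN !hornerX !hornerC.
  by apply: lerB; apply: Pmono; lra.
Qed.
End KernelEstimates.

(** * The majorant of the indicator function *)

Section Majorant.
Variables (R : realType) (n : nat).
Notation mu := (@lebesgue_measure R).
Implicit Types (x y z : Rn R n) (g : mpoly n R).

Lemma measurable_semialg r (h : 'I_r -> mpoly n R) : measurable (semialg h).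
Proof.
rewrite (_ : semialg h = \bigcap_(i in [set: 'I_r])
  (peval (h i) @^-1` [set` `[0, +oo[])).
  apply: fin_bigcap_measurable => // i _.
  rewrite -[X in measurable X]setTI; apply: measurable_peval => //.
apply/seteqP; split=> x /= H i; last by have := H i Logic.I; rewrite /= in_itv /= andbT.
by move=> _ /=; rewrite in_itv /= andbT.
Qed.

Definition diff_kernel (E : {poly R}) x y : R := \prod_i E.[tnth x i - tnth y i].

Lemma measurable_diff_kernel E x : measurable_fun [set: Rn R n] (diff_kernel E x).
Proof.
apply: measurable_prod => i _; apply: measurableT_comp; first exact: measurable_poly.
by apply: measurable_funB => //; exact: measurable_tnth.
Qed.

Lemma separable_diff_kernel (E : {poly R}) k : (size E <= k.+1)%N ->
  separable (n * k) (diff_kernel E).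
Proof. by move=> sE; apply: separable_prod => i; exact: separable_diff. Qed.

(** Intermediate value theorem on the segment from [x] to [y]. *)
Lemma segment_zero g x y : 0 <= peval g x -> peval g y < 0 ->
  exists z, peval g z = 0 /\ forall i, exists2 c, 0 <= c <= 1 &
    tnth z i - tnth x i = c * (tnth y i - tnth x i).
Proof.
move=> gx gy; pose u i := tnth y i - tnth x i.
have l0 : (line g x u).[0] = peval g x by rewrite horner_line shift0.
have l1 : (line g x u).[1] = peval g y.
  rewrite horner_line; congr peval; apply: eq_from_tnth => i.
  by rewrite tnth_shift mulr1 addrC subrK.
have [|c c01 /rootP gc] := @polyrcf.poly_ivt _ (line g x u) 0 1 ler01.
  by rewrite l0 l1 mulr_ge0_le0 // ltW.
exists (shift x u c); split; first by rewrite -horner_line.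
move=> i; exists c; first by move: c01; rewrite in_itv.
by rewrite tnth_shift addrAC subrr add0r mulrC.
Qed.

Section Scale.
Variables (m : nat) (E : {poly R}).
Hypothesis m0 : (0 < m)%N.
Hypothesis EL : forall s : R, `|s| <= 5 ->
  2^-1 <= E.[s] * (1 + m%:R ^+ 2 * s ^+ 2) <= 2.

Let mR : (0 : R) < m%:R. Proof. by rewrite ltr0n. Qed.

Lemma diff_kernel_ge0 x y : (forall i, `|tnth x i - tnth y i| <= 5) ->
  0 <= diff_kernel E x y.
Proof. by move=> xy; apply: prodr_ge0 => i _; rewrite ltW // (kernel_gt0 EL). Qed.

(** The segment from [x] to [y] meets the zero set of some [h_j] at a point [z],
    coordinatewise at most as far from [x] as [y] is.  The box [Z] of side [2/m]
    around [z] lies in [B], and for [z'] in [Z] one has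
    [K(x,y) <= 12^n K(x,z')]; average over [Z]. *)
Lemma kernel_le_boundary_mass r (h : 'I_r -> mpoly n R) (B : set (Rn R n)) x y :
  semialg h `<=` cube R n -> measurable B -> B `<=` box 4 ->
  (forall j, log_derivative_set (h j) (n%:R * (4 * m%:R^-1)) 4 `<=` B) ->
  semialg h x -> ~ semialg h y -> (forall i, `|tnth x i - tnth y i| <= 2) ->
  ((diff_kernel E x y)%:E <=
    ((6 * m%:R) ^+ n)%:E * \int[leb R n]_(z in B) (diff_kernel E x z)%:E)%E.
Proof.
move=> Xcube mB B4 hB Xx Xy xy2.
have [j hjy] : exists j, peval (h j) y < 0.
  apply: contrapT => H; apply: Xy => j; rewrite leNgt; apply/negP => lt.
  by apply: H; exists j.
have [z [hjz xyz]] := segment_zero (Xx j) hjy.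
have x1 i : -1 <= tnth x i <= 1 by exact: Xcube.
pose v : R := m%:R^-1.
have v0 : 0 < v by rewrite invr_gt0.
have v1 : v <= 1 by rewrite invf_le1 // ler1n.
have xz i : `|tnth z i - tnth x i| <= `|tnth x i - tnth y i|.
  have [c /andP[c0 c1] ->] := xyz i; rewrite normrM ger0_norm // distrC.
  by rewrite ler_piMl.
pose Z := slab (fun i => tnth z i - v) (fun i => tnth z i + v).
(* x is in the cube, z is within 2 of x, and Z within 1 of z. *)
have Z4 : Z `<=` box 4.
  move=> z' Zz' i; have := Zz' i; have := x1 i; have := le_trans (xz i) (xy2 i).
  by rewrite /= !ler_norml => *; lra.
have ZB : Z `<=` B.
  move=> z' Zz'; apply: (hB j); apply: (@zero_near_log_derivative_set _ _ _ v 4 z' z) => //.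
  - by exists y; rewrite lt_eqF.
  - by move=> i; have := Zz' i; rewrite /= ler_norml => *; lra.
  - exact: Z4.
have mZ : measurable Z by exact: measurable_slab.
have x5 z' : box 4 z' -> forall i, `|tnth x i - tnth z' i| <= 5.
  by move=> z'4 i; have := x1 i; have := z'4 i; rewrite /= ler_norml => *; lra.
have mk D : measurable_fun D (fun z => (diff_kernel E x z)%:E).
  apply/measurable_EFinP; apply: measurable_funS (measurable_diff_kernel E x) => //.
have xyk z' : Z z' -> diff_kernel E x y <= 12 ^+ n * diff_kernel E x z'.
  move=> Zz'; rewrite /diff_kernel -[X in 12 ^+ X]card_ord -prodr_const -big_split /=.
  apply: ler_prod => i _; have x'5 := x5 _ (Z4 _ Zz') i.
  have y5 : `|tnth x i - tnth y i| <= 5 by rewrite (le_trans (xy2 i)) // ler_nat.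
  rewrite ltW ?(kernel_gt0 EL) //=; apply: (kernel_compare m0 EL) => //.
  have := xz i; have := Zz' i; rewrite /= -/v => Zi xzi.
  apply: le_trans (_ : `|tnth x i - tnth z i| + `|tnth z i - tnth z' i| <= _).
    by rewrite -[X in `|X|](subrKA (tnth z i)) ler_normD.
  by rewrite lerD //; [rewrite distrC|rewrite ler_norml; lra].
have lebZ : leb R n Z = ((2 * v) ^+ n)%:E.
  rewrite -lebE /Z (@lebesgue_Rn_box R n (fun i => tnth z i - v) (fun i => tnth z i + v)).
    rewrite -[X in _ ^+ X]card_ord -prodr_const; congr _%:E.
    by apply: eq_bigr => i _; ring.
  by move=> i; lra.
have kxy0 : 0 <= diff_kernel E x y.
  by apply: diff_kernel_ge0 => i; rewrite (le_trans (xy2 i)) // ler_nat.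
have -> : diff_kernel E x y = (6 * m%:R) ^+ n * ((12 ^+ n)^-1 * diff_kernel E x y * (2 * v) ^+ n).
  have -> : (6 * m%:R) ^+ n * ((12 ^+ n)^-1 * diff_kernel E x y * (2 * v) ^+ n) =
    ((6 * m%:R) * 12^-1 * (2 * v)) ^+ n * diff_kernel E x y 
    by rewrite -[(12 ^+ n)^-1]exprVn !exprMn; ring.
  rewrite (_ : 6 * m%:R / 12 * (2 * v) = 1) ?expr1n ?mul1r // /v.
  by field; rewrite gt_eqF.
rewrite EFinM lee_wpmul2l ?lee_fin ?exprn_ge0 ?mulr_ge0 //.
apply: (@le_trans _ _ (\int[leb R n]_(z in Z) (diff_kernel E x z)%:E)%E); last first.
  apply: ge0_subset_integral => // z' /B4/x5 ?.
  by rewrite lee_fin diff_kernel_ge0.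
rewrite EFinM -lebZ -integral_cst //.
apply: ge0_le_integral => //.
- by move=> z' _; rewrite /= lee_fin mulr_ge0 // invr_ge0 exprn_ge0.
- move=> z' Zz'; rewrite /= lee_fin mulrC ler_pdivrMr ?exprn_gt0 // mulrC.
  exact: xyk.
Qed.
End Scale.
End Majorant.

Section MajorantRate.
Variables (R : realType) (n r : nat) (h : 'I_r -> mpoly n R).
Notation mu := (@lebesgue_measure R).
Implicit Types (x y z : Rn R n).
Hypothesis Xcube : semialg h `<=` cube R n.

(** The union over [j] of the sets that surround the zero sets of the [h_j]. *)
Lemma boundary_cover : exists2 C : R, 0 <= C & forall t, 0 <= t ->
  exists B : set (Rn R n), [/\ measurable B, B `<=` box 4,
    forall j, log_derivative_set (h j) t 4 `<=` B & (leb R n B <= (C * t)%:E)%E].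
Proof.
have /choice[c Hc] : forall j, exists c : R, 0 <= c /\ forall t, 0 <= t ->
    measurable (log_derivative_set (h j) t 4) /\
    (leb R n (log_derivative_set (h j) t 4) <= (c * t)%:E)%E.
  move=> j; have [|c c0 Hc] := @leb_log_derivative_set R n (h j) 4; first by [].
  by exists c.
pose C := \sum_j c j.
have cC j : c j <= C.
  by rewrite /C (bigD1 j) //= lerDl sumr_ge0 // => i _; have [] := Hc i.
exists (r%:R * C); first by rewrite mulr_ge0 // sumr_ge0 // => j _; have [] := Hc j.
move=> t t0; exists (\big[setU/set0]_(j <- enum 'I_r) log_derivative_set (h j) t 4).
split.
- by apply: bigsetU_measurable => j _; have [_ /(_ t t0)[]] := Hc j.
- by rewrite -bigcup_seq => x [j _ []].
- by move=> j x Hx; rewrite -bigcup_seq; exists j => //=; rewrite mem_enum.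
- apply: le_trans (measure_bigsetU_seq_le (c := C * t) _ _) _.
  + by move=> j _; have [_ /(_ t t0)[]] := Hc j.
  + move=> j _; have [_ /(_ t t0)[_]] := Hc j => /le_trans; apply.
    by rewrite lee_fin ler_wpM2r.
  + by rewrite size_enum_ord mulrA.
Qed.

Section Scale.
Variables (m : nat) (E : {poly R}) (B : set (Rn R n)).
Hypothesis m0 : (0 < m)%N.
Hypothesis sE : (size E <= (10 * m).+1)%N.
Hypothesis EL : forall s : R, `|s| <= 5 ->
  2^-1 <= E.[s] * (1 + m%:R ^+ 2 * s ^+ 2) <= 2.
Hypotheses (mB : measurable B) (B4 : B `<=` box 4).
Hypothesis hB : forall j, log_derivative_set (h j) (n%:R * (4 * m%:R^-1)) 4 `<=` B.

Let mR : (0 : R) < m%:R. Proof. by rewrite ltr0n. Qed.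
Let X := semialg h.
Let mX : measurable X. Proof. exact: measurable_semialg. Qed.

Let cube5 x y : cube R n x -> box 4 y -> forall i, `|tnth x i - tnth y i| <= 5.
Proof.
by move=> x1 y4 i; have := x1 i; have := y4 i; rewrite /= ler_norml => *; lra.
Qed.

(** The differences between points of the cube and of [B] lie in [-5, 5], where [E]
    is controlled. *)
Lemma correction_term : exists v, [/\ deg_le v (n * (10 * m)),
  forall x, (\int[leb R n]_(y in B) (diff_kernel E x y)%:E = (peval v x)%:E)%E &
  (integral_cube v <= ((8 / m%:R) ^+ n)%:E * leb R n B)%E].
Proof.
apply: separable_integral (separable_diff_kernel n sE) mB B4 _ => y By.
have y4 := B4 By.
rewrite (_ : cube R n = slab (fun=> -1) (fun=> 1)) //.
rewrite (eq_integral (fun x : Rn R n =>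
  (\prod_i (E \Po ('X - (tnth y i)%:P)).[tnth x i])%:E)); last first.
  move=> x _; congr _%:E; apply: eq_bigr => i _.
  by rewrite horner_comp !hornerE.
have y5 i s : -1 <= s <= 1 -> `|s - tnth y i| <= 5.
  by move=> s1; have := y4 i; rewrite /= ler_norml => *; lra.
apply: integral_slab_prod_le => i.
  move=> s s1; rewrite horner_comp !hornerE ltW // (kernel_gt0 EL) //.
  exact: y5.
apply: (integral_kernel_le m0 EL (y := tnth y i)) => [|s|s s1]; first lra.
  exact: y5.
by left; rewrite horner_comp !hornerE.
Qed.

(** The indicator function of X convolved with the normalized square of the
    kernel; its total mass seen from [x] in the cube is 1 on a box containing X. *)
Lemma smoothed_indicator : exists N v, [/\ (8 * m%:R)^-1 <= N, deg_le v (n * (20 * m)),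
  forall x, (\int[leb R n]_(y in X) ((N ^+ n)^-1 * diff_kernel (E ^+ 2) x y)%:E =
    (peval v x)%:E)%E,
  forall x, (\int[leb R n]_(y in slab (fun i => (tnth x i - 2)%R) (fun i => (tnth x i + 2)%R))
    ((N ^+ n)^-1 * diff_kernel (E ^+ 2) x y)%:E = 1)%E &
  (integral_cube v <= leb R n X)%E].
Proof.
have [N [N8 Nx Ny]] := kernel_square_mass m0 EL.
have N0 : 0 < N by apply: lt_le_trans N8; rewrite invr_gt0 mulr_gt0.
have NN : (N ^+ n)^-1 * N ^+ n = 1 by rewrite mulVf // gt_eqF // exprn_gt0.
have iN0 : 0 <= (N ^+ n)^-1 by rewrite invr_ge0 exprn_ge0 // ltW.
have sE2 : (size (E ^+ 2)%R <= (20 * m).+1)%N.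
  rewrite (leq_trans (size_poly_exp_leq _ _)) // ltnS.
  rewrite (_ : (20 * m = (10 * m) * 2)%N); last by lia.
  by rewrite leq_mul2r /= -subn1 leq_subLR add1n.
have sep : separable (n * (20 * m)) (fun x y => (N ^+ n)^-1 * diff_kernel (E ^+ 2) x y).
  rewrite -[X in separable X]add0n; apply: separableM (separable_cst _ _) _.
  exact: separable_diff_kernel.
have sq0 (i : 'I_n) (p : {poly R}) s : 0 <= (E ^+ 2 \Po p).[s].
  by rewrite horner_comp horner_exp sqr_ge0.
have kZ D x : measurable D -> (\int[leb R n]_(y in D) ((N ^+ n)^-1 * diff_kernel (E ^+ 2) x y)%:E =
    ((N ^+ n)^-1)%:E * \int[leb R n]_(y in D) (diff_kernel (E ^+ 2) x y)%:E)%E.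
  move=> mD; under eq_integral do rewrite EFinM.
  rewrite ge0_integralZl //.
  - apply/measurable_EFinP; apply: measurable_funS (measurable_diff_kernel (E ^+ 2) x) => //.
  - by move=> y _; rewrite lee_fin prodr_ge0 // => i _; rewrite horner_exp sqr_ge0.
have [|v [dv vE vI]] := @separable_integral _ _ _ _ X 1 1 sep mX Xcube.
  move=> y Xy.
  rewrite (_ : cube R n = slab (fun=> -1) (fun=> 1)) //.
  rewrite (eq_integral (fun x : Rn R n => (((N ^+ n)^-1)%:E *
    (\prod_i (E ^+ 2 \Po ('X - (tnth y i)%:P)).[tnth x i])%:E)%E)); last first.
    move=> x _; rewrite -EFinM; congr (_ * _)%:E; apply: eq_bigr => i _.
    by rewrite horner_comp !hornerE.
  rewrite ge0_integralZl //.
  - apply: (@le_trans _ _ (((N ^+ n)^-1)%:E * (N ^+ n)%:E)%E); last by rewrite -EFinM NN.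
    rewrite lee_wpmul2l ?lee_fin //.
    apply: integral_slab_prod_le => i; first by move=> s _; exact: sq0.
    by apply: Ny; rewrite ler_norml; exact: Xcube.
  - exact: measurable_slab.
  - apply/measurable_EFinP; apply: measurable_prod => i _.
    apply: measurableT_comp; first exact: measurable_poly.
    apply: measurable_funS (measurable_tnth i) => //.
  - by move=> x _; rewrite lee_fin prodr_ge0 // => i _; exact: sq0.
exists N, v; split=> //; last by rewrite mul1e in vI.
move=> x; rewrite kZ; last exact: measurable_slab.
rewrite (eq_integral (fun y : Rn R n =>
    (\prod_i (E ^+ 2 \Po ((tnth x i)%:P - 'X)).[tnth y i])%:E)); last first.
  by move=> y _; congr _%:E; apply: eq_bigr => i _; rewrite horner_comp !hornerE.
rewrite (@integral_slab_prod _ n _ _ _ (fun i s _ => sq0 i _ s) N) => [|i].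
  by rewrite -EFinM NN.
exact: Nx.
Qed.

(** The smoothed indicator plus [(8 * 6 * 8 m)^n] times the correction term.  The
    factors come from [N^-1 <= 8 m], from the [6 m] of [kernel_le_boundary_mass]
    and from the bound [8 / m] on the integrals of [E]. *)
Lemma majorant_at_scale : exists v, majorants X (20 * n * m) v /\
  (integral_cube v <= leb R n X + ((8 * 6 * 8 * 8) ^+ n)%:E * leb R n B)%E.
Proof.
have [v2 [d2 v2E v2I]] := correction_term.
have [N [v1 [N8 d1 v1E v1W v1I]]] := smoothed_indicator.
have N0 : 0 < N by apply: lt_le_trans N8; rewrite invr_gt0 mulr_gt0.
have iN0 : 0 <= (N ^+ n)^-1 by rewrite invr_ge0 exprn_ge0 // ltW.
pose A : R := ((8 * 6 * 8) * m%:R) ^+ n.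
have A0 : 0 <= A.
  by rewrite exprn_ge0 // !mulr_ge0.
have F1ge0 x y : 0 <= (N ^+ n)^-1 * diff_kernel (E ^+ 2) x y.
  by rewrite mulr_ge0 // prodr_ge0 // => i _; rewrite horner_exp sqr_ge0.
have F1ge0E (D : set (Rn R n)) x y :
    D y -> (0 <= ((N ^+ n)^-1 * diff_kernel (E ^+ 2) x y)%:E)%E.
  by rewrite lee_fin.
have v1ge0 x : 0 <= peval v1 x.
  by rewrite -lee_fin -v1E integral_ge0 // => y _; rewrite lee_fin.
have v2ge0 x : cube R n x -> 0 <= peval v2 x.
  move=> xK; rewrite -lee_fin -v2E integral_ge0 // => y /B4 yB; rewrite lee_fin.
  by apply: (diff_kernel_ge0 EL); exact: cube5.
have vE x : peval (v1 + A *: v2) x = peval v1 x + A * peval v2 x.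
  by rewrite /peval mevalD mevalZ.
exists (v1 + A *: v2); split; last first.
  have mK : measurable (cube R n) by exact: measurable_box.
  have KK : cube R n `<=` box 1 by [].
  have icE p : integral_cube p = (polyint (cube R n) p)%:E.
    by rewrite /integral_cube lebE (polyintE mK KK).
  move: v1I v2I; rewrite !icE (polyintD mK KK) (polyintZ mK KK) => v1I v2I.
  rewrite EFinD; apply: leeD; first exact: v1I.
  rewrite EFinM; apply: le_trans (lee_wpmul2l _ v2I) _; first by rewrite lee_fin.
  rewrite muleA -EFinM /A -exprMn.
  have -> : (8 * 6 * 8) * m%:R * (8 / m%:R) = (8 * 6 * 8 * 8) :> R.
    by field; rewrite gt_eqF.
  exact: lexx.
split.
  rewrite /deg_le (leq_trans (msizeD_le _ _)) // geq_max.
  apply/andP; split.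
    by apply: leq_trans d1 _; rewrite (mulnC 20%N n) mulnA.
  apply: leq_trans (msizeZ_le _ _) _; apply: leq_trans d2 _.
  by rewrite (mulnC 20%N n) -mulnA ltnS !leq_mul2l leq_mul2r orbT !orbT.
move=> x xK; rewrite vE.
have Av2 : 0 <= A * peval v2 x by rewrite mulr_ge0 // v2ge0.
rewrite indicE; case: (boolP (x \in X)) => [/set_mem Xx|_]; last by rewrite addr_ge0.
pose W := slab (fun i => tnth x i - 2) (fun i => tnth x i + 2).
have mW : measurable W by exact: measurable_slab.
have XW : X `<=` W.
  by move=> y /Xcube y1 i; have := y1 i; have := xK i; lra.
have mG D (p : {poly R}) : measurable_fun D (diff_kernel p x).
  by apply: measurable_funS (measurable_diff_kernel p x).
have mF D (p : {poly R}) : measurable_fun D (fun y => (diff_kernel p x y)%:E).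
  by apply/measurable_EFinP; exact: mG.
have mF1 D : measurable_fun D (fun y => ((N ^+ n)^-1 * diff_kernel (E ^+ 2) x y)%:E).
  by apply/measurable_EFinP; apply: measurable_funM => //; exact: mG.
have W2 y : W y -> forall i, `|tnth x i - tnth y i| <= 2.
  by move=> Wy i; have := Wy i; rewrite /= ler_norml => *; lra.
have W5 y : W y -> forall i, `|tnth x i - tnth y i| <= 5.
  by move=> Wy i; rewrite (le_trans (W2 _ Wy i)) // ler_nat.
rewrite -lee_fin EFinD -v1E -(v1W x) -/W.
have -> : W = X `|` (W `\` X) by exact/esym/setDUK.
have mWX : measurable (W `\` X) by exact: measurableD.
rewrite ge0_integral_setU //; first last.
- by rewrite disj_set2E setDIK.
- by move=> y; exact: F1ge0E.
apply: leeD => //.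
(* What is missing from the first term is the mass outside of X. *)
pose c : R := (N ^+ n)^-1 * ((6 * m%:R) ^+ n * peval v2 x).
have c0 : 0 <= c by rewrite mulr_ge0 // mulr_ge0 ?exprn_ge0 ?mulr_ge0 // v2ge0.
apply: (@le_trans _ _ (\int[leb R n]_(y in W) (c%:E * (diff_kernel E x y)%:E))%E).
  apply: (@le_trans _ _ (\int[leb R n]_(y in W `\` X) (c%:E * (diff_kernel E x y)%:E))%E).
    apply: ge0_le_integral => //.
    - by move=> y; exact: F1ge0E.
    - by apply: measurable_funeM; exact: mF.
    - move=> y [Wy Xy]; rewrite -EFinM lee_fin /c -mulrA ler_wpM2l //.
      have -> : diff_kernel (E ^+ 2) x y = diff_kernel E x y * diff_kernel E x y.
        rewrite /diff_kernel -big_split /=; apply: eq_bigr => i _.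
        by rewrite horner_exp expr2.
      rewrite ler_wpM2r ?(diff_kernel_ge0 EL) //; first exact: W5.
      have := kernel_le_boundary_mass m0 EL Xcube mB B4 hB Xx Xy (W2 _ Wy).
      by rewrite v2E -EFinM lee_fin.
  apply: ge0_subset_integral => //.
  - by apply: measurable_funeM; exact: mF.
  - by move=> y Wy; rewrite -EFinM lee_fin mulr_ge0 // (diff_kernel_ge0 EL) //; exact: W5.
rewrite ge0_integralZl //; last first.
  by move=> y Wy; rewrite lee_fin (diff_kernel_ge0 EL) //; exact: W5.
apply: (@le_trans _ _ (c%:E * ((8 / m%:R) ^+ n)%:E)%E).
  rewrite lee_wpmul2l ?lee_fin //.
  rewrite (eq_integral (fun y : Rn R n =>
    (\prod_i (E \Po ((tnth x i)%:P - 'X)).[tnth y i])%:E)); last first.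
    by move=> y _; congr _%:E; apply: eq_bigr => i _; rewrite horner_comp !hornerE.
  apply: integral_slab_prod_le => i.
    move=> s s2; rewrite horner_comp !hornerE ltW // (kernel_gt0 EL) //.
    by rewrite ler_norml; lra.
  apply: (integral_kernel_le m0 EL (y := tnth x i)) => [|s s2|s s2]; first lra.
    by rewrite ler_norml; lra.
  by right; rewrite horner_comp !hornerE.
rewrite -EFinM lee_fin /c -mulrA.
apply: (@le_trans _ _ ((8 * m%:R) ^+ n * ((6 * m%:R) ^+ n * peval v2 x * (8 / m%:R) ^+ n))).
  rewrite ler_wpM2r //.
    by rewrite !mulr_ge0 ?exprn_ge0 ?mulr_ge0 ?divr_ge0 ?v2ge0.
  have NV : N^-1 <= 8 * m%:R.
    by rewrite -[leRHS]invrK lef_pV2 ?posrE ?invr_gt0 ?mulr_gt0.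
  rewrite -exprVn; apply: lerXn2r; rewrite ?nnegrE ?invr_ge0 ?mulr_ge0 //.
  exact: ltW.
have -> : (8 * m%:R) ^+ n * ((6 * m%:R) ^+ n * peval v2 x * (8 / m%:R) ^+ n) =
   (8 * m%:R * (6 * m%:R) * (8 / m%:R)) ^+ n * peval v2 x by rewrite !exprMn; ring.
have -> : 8 * m%:R * (6 * m%:R) * (8 / m%:R) = (8 * 6 * 8) * m%:R :> R.
  by field; rewrite gt_eqF.
exact: lexx.
Qed.
End Scale.

Theorem majorant_rate : exists C : R, 0 < C /\
  forall m, (0 < m)%N -> exists v, majorants (semialg h) (20 * n * m) v /\
  (integral_cube v <= leb R n (semialg h) + (C / m%:R)%:E)%E.
Proof.
have [C C0 HC] := boundary_cover.
exists ((8 * 6 * 8 * 8) ^+ n * (C * (n%:R * 4)) + 1); split.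
  by rewrite ltr_wpDl // !mulr_ge0 ?exprn_ge0.
move=> m m0; have mR : (0 : R) < m%:R by rewrite ltr0n.
have [E [sE EL]] := @lorentzian_kernel R m m0.
have [|B [mB B4 hB lebB]] := HC (n%:R * (4 * m%:R^-1)).
  by rewrite !mulr_ge0 // invr_ge0.
have [v [vX vI]] := majorant_at_scale m0 sE EL mB B4 hB.
exists v; split=> //; apply: le_trans vI _; rewrite leeD2l //.
apply: le_trans (lee_wpmul2l _ lebB) _; first by rewrite lee_fin exprn_ge0 // !mulr_ge0.
rewrite -EFinM lee_fin; set M := (_ ^+ n).
have -> : M * (C * (n%:R * (4 / m%:R))) = M * (C * (n%:R * 4)) / m%:R by ring.
by rewrite [leRHS](mulrDl (M * (C * (n%:R * 4))) 1) lerDl divr_ge0.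
Qed.
End MajorantRate.

(** * From majorants to the hierarchy *)

Section Assembly.
Variables (R : realType) (n : nat).
Implicit Types (x y : Rn R n) (p : mpoly n R).

Lemma unit_ball_cube (A : set (Rn R n)) :
  (forall x, A x -> enorm (tnth x) <= 1) -> A `<=` cube R n.
Proof.
move=> A1 x /A1 nx i; rewrite -ler_norml -(@expr_le1 _ 2) // real_normK ?num_real //.
have s0 : 0 <= \sum_j tnth x j ^+ 2 by apply: sumr_ge0 => j _; exact: sqr_ge0.
have : \sum_j tnth x j ^+ 2 <= 1.
  by rewrite -(sqr_sqrtr s0) expr_le1 ?sqrtr_ge0.
apply: le_trans; rewrite (bigD1 i) //= lerDl sumr_ge0 // => j _; exact: sqr_ge0.
Qed.

(** The distance to an empty set is infinite, and so is its power [L]. *)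
Lemma lojasiewicz_nonempty r (h : 'I_r -> mpoly n R) L :
  is_lojasiewicz_exponent h L -> exists x, semialg h x.
Proof.
move=> [L0 [c c0 Hc]]; apply: contrapT => X0.
have /Hc : cube R n [tuple 0 | i < n] by move=> i; rewrite tnth_mktuple; lra.
have -> : semialg h = set0 by apply/seteqP; split=> // x Xx; apply: X0; exists x.
by rewrite /edist_set image_set0 ereal_inf0 poweRyr ?gt_eqF // leye_eq.
Qed.

Lemma max_abs_cube_le p M : (forall x, cube R n x -> `|peval p x| <= M) ->
  max_abs_cube p <= M.
Proof.
move=> pM; apply: ge_sup.
  by exists `|peval p [tuple 0 | i < n]|, [tuple 0 | i < n] => // i; rewrite tnth_mktuple; lra.
by move=> _ [x xK <-]; exact: pM.
Qed.

Lemma max_abs_cube_ge0 p : 0 <= max_abs_cube p.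
Proof.
pose x0 : Rn R n := [tuple 0 | i < n].
have x0K : cube R n x0 by move=> i; rewrite tnth_mktuple; lra.
apply: le_trans (normr_ge0 (peval p x0)) _; apply: ub_le_sup; last by exists x0.
have [M _ pM] := peval_bounded p 1.
by exists M => _ [x xK <-]; exact: pM.
Qed.

Lemma le_max_cube p x : cube R n x -> peval p x <= max_cube p.
Proof.
move=> xK; apply: ub_le_sup; last by exists x.
have [M _ pM] := peval_bounded p 1.
by exists M => _ [y yK <-]; apply: le_trans (ler_norm _) (pM _ _).
Qed.

Lemma integral_cube_addC p (c : R) :
  integral_cube (p + c *: 1) = (integral_cube p + (c * 2 ^+ n)%:E)%E.
Proof.
have mK : measurable (cube R n) by exact: measurable_box.
have KK : cube R n `<=` box 1 by [].
have icE q : integral_cube q = (polyint (cube R n) q)%:E.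
  by rewrite /integral_cube lebE (polyintE mK KK).
rewrite !icE (polyintD mK KK) (polyintZ mK KK) EFinD; congr (_ + (_ * _)%:E)%E.
apply: EFin_inj; rewrite -icE /integral_cube lebE.
rewrite (eq_integral (cst 1%E)) => [|x _]; last by rewrite /peval meval1.
rewrite integral_cst // mul1e.
have := @leb_box R n 1 ler01; rewrite mulr1; exact.
Qed.

(** Once [deg p] and the ratio are replaced by their bounds [a] and [M / eta], which
    are at least 1, the exponent [L] may be raised to [Lhat]. *)
Lemma putinar_membership r (h : 'I_r -> mpoly n R) (L g G Lhat a M eta : R) p (l : nat) :
  is_putinar_constant h L g -> 0 < L -> L <= Lhat -> g <= G ->
  (exists x, semialg h x) ->
  0 < eta -> (forall x, semialg h x -> eta <= peval p x) ->
  max_abs_cube p <= M -> 1 <= M / eta -> 1 <= a -> (deg p)%:R <= a ->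
  G * a `^ (7 / 2 * n%:R * Lhat) * (M / eta) `^ (5 / 2 * n%:R * Lhat) <= l%:R ->
  truncated_quadratic_module h l p.
Proof.
move=> [g1 Hp] L0 LL gG [x0 Xx0] eta0 peta pM M1 a1 pa Gl; apply: Hp.
  by move=> x /peta; exact: lt_le_trans.
apply: le_trans Gl.
have inf_ge : eta <= inf [set peval p x | x in semialg h].
  by apply: lb_le_inf; [exists (peval p x0), x0|move=> _ [x Xx <-]; exact: peta].
have inf0 := lt_le_trans eta0 inf_ge.
have M0 := max_abs_cube_ge0 p.
have G0 : 0 <= G by lra.
have nn : (0 : R) <= n%:R by [].
have powLe (b c k : R) : 0 <= b -> b <= c -> 1 <= c -> 0 <= k ->
    b `^ (k * n%:R * L) <= c `^ (k * n%:R * Lhat).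
  move=> b0 bc c1 k0; have c0 : 0 <= c by lra.
  have kn0 : 0 <= k * n%:R by rewrite mulr_ge0.
  apply: (@le_trans _ _ (c `^ (k * n%:R * L))).
    by apply: ge0_ler_powR; rewrite ?nnegrE // mulr_ge0 // ltW.
  by apply: ler_powR => //; rewrite ler_wpM2l.
apply: ler_pM; rewrite ?powR_ge0 ?mulr_ge0 ?powR_ge0 //; first lra.
  apply: ler_pM; rewrite ?powR_ge0 //; first lra.
  exact: powLe.
apply: powLe => //.
  by rewrite divr_ge0 // ltW.
by apply: ler_pM => //; rewrite ?invr_ge0 ?lef_pV2 ?posrE // ltW.
Qed.

Lemma degree_bound_bigO (g cG L C : R) : 0 <= g -> 0 <= cG -> 0 <= L -> 0 <= C ->
  degree_bound n g cG L C =O_ (0^'+) (fun eps : R => 1 / eps `^ (6 * n%:R * L)).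
Proof.
move=> g0 cG0 L0 C0; apply/eqO_exP.
pose a : R := 7 / 2 * n%:R * L; pose b : R := 5 / 2 * n%:R * L.
have a0 : 0 <= a by rewrite !mulr_ge0.
have b0 : 0 <= b by rewrite !mulr_ge0.
pose D := 1 + 2 ^+ n.+1 * cG.
have D0 : 0 <= D by rewrite addr_ge0 // mulr_ge0 // exprn_ge0.
pose k := g * C `^ a * D `^ b.
exists (k + 1); first by rewrite ltr_wpDl // !mulr_ge0 ?powR_ge0.
near=> e.
have e0 : 0 < e by near: e; exact: nbhs_right_gt.
have e1 : e < 1 by near: e; exact: nbhs_right_lt.
have ie0 : 0 <= e^-1 by rewrite invr_ge0 ltW.
have rhs : 1 / e `^ (6 * n%:R * L) = e^-1 `^ a * e^-1 `^ b.
  rewrite -powRD; last by apply/implyP => _; rewrite invr_eq0 gt_eqF.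
  rewrite (_ : a + b = 6 * n%:R * L); last by rewrite /a /b; lra.
  by rewrite div1r -powRN -[e^-1]powR_inv1 ?ltW // -powRrM mulN1r.
rewrite rhs /degree_bound -/a -/b !ger0_norm ?mulr_ge0 ?powR_ge0 //.
apply: (@le_trans _ _ (k * (e^-1 `^ a * e^-1 `^ b))); last first.
  by rewrite ler_wpM2r ?lerDl // mulr_ge0 ?powR_ge0.
have -> : k * (e^-1 `^ a * e^-1 `^ b) = g * (C `^ a * e^-1 `^ a) * (D `^ b * e^-1 `^ b).
  by rewrite /k; ring.
rewrite -!powRM //; apply: ler_wpM2l; first by rewrite mulr_ge0 ?powR_ge0.
have B0 : 0 <= 2 ^+ n.+1 * (cG / e) by rewrite mulr_ge0 ?exprn_ge0 ?mulr_ge0.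
apply: ge0_ler_powR; rewrite ?nnegrE ?addr_ge0 ?mulr_ge0 //.
rewrite /D mulrDl mul1r mulrA lerD2r -[1]invr1 lef_pV2 ?posrE //; exact: ltW.
Unshelve. all: by end_near.
Qed.
End Assembly.

Theorem theorem5p3 (R : realType) (n r : nat) (h : 'I_r -> mpoly n R)
    (L gamma_h gamma_f cG : R)
    (h_ball : forall x, semialg h x -> enorm (tnth x) <= 1)
    (h_arch : quadratic_module h (ball_poly R n))
    (h_bound : forall i, max_abs_cube (h i) <= 1 / 2)
    (h_loja : is_lojasiewicz_exponent h L)
    (h_putinar : is_putinar_constant h L gamma_h)
    (f_putinar : is_putinar_constant (@cube_polys R n) 1 gamma_f)
    (h_gibbs : finite_gibbs (semialg h) cG) :
  let gamma := Num.max gamma_f gamma_h in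
  let Lhat := Num.max L 1 in
  exists C : R,
    [/\ 0 < C,
        forall eps : R, 0 < eps < 1 ->
        forall l : nat, degree_bound n gamma cG Lhat C eps <= l%:R ->
          (sos_volume h l - lebesgue_Rn (semialg h) < eps%:E)%E &
        degree_bound n gamma cG Lhat C =O_ (0^'+)
          (fun eps : R => 1 / eps `^ (6 * n%:R * Lhat))].
Proof.
move=> gamma Lhat.
have Xcube := unit_ball_cube h_ball.
have [x0 Xx0] := lojasiewicz_nonempty h_loja.
have [C1 [C10 rate]] := majorant_rate Xcube.
have [cG0 [w wP]] := h_gibbs.
have L0 : 0 < L by have [] := h_loja.
have Lhat1 : 1 <= Lhat by rewrite /Lhat le_max lexx orbT.
have LLhat : L <= Lhat by rewrite /Lhat le_max lexx.
have gf1 : 1 <= gamma_f by have [] := f_putinar.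
have gfG : gamma_f <= gamma by rewrite /gamma le_max lexx.
have ghG : gamma_h <= gamma by rewrite /gamma le_max lexx orbT.
have gamma1 : 1 <= gamma by apply: le_trans gfG.
have nR0 : (0 : R) <= n%:R by [].
have finX : leb R n (semialg h) \is a fin_num.
  rewrite ge0_fin_numE //; apply: (leb_bounded_fin (a := 1)); last exact: Xcube.
  exact: measurable_semialg.
pose C := (20 * n)%:R * (2 * C1 + 1) + 1.
have C_ge1 : 1 <= C by rewrite lerDr mulr_ge0 //; lra.
exists C; split; first lra; last first.
  by apply: degree_bound_bigO => //; lra.
move=> e /andP[e0 e1] l le_l.
(* The scale is chosen so that C1 / m < eps / 2. *)
pose m := (Num.truncn (2 * C1 / e)).+1.
have m_gt : 2 * C1 / e < m%:R by exact: truncnS_gt.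
have m_le : m%:R <= (2 * C1 + 1) / e.
  have -> : m%:R = (Num.truncn (2 * C1 / e))%:R + 1 :> R by rewrite natr1.
  have : (Num.truncn (2 * C1 / e))%:R <= 2 * C1 / e.
    by rewrite truncn_le divr_ge0 // ?ltW // mulr_gt0.
  have : 1 <= 1 / e by rewrite ler_pdivlMr // mul1r ltW.
  by rewrite (mulrDl (2 * C1)); lra.
pose d := (20 * n * m)%N.
have Ce1 : 1 <= C / e by rewrite ler_pdivlMr //; lra.
have d_le : d%:R <= C / e.
  rewrite /d natrM; apply: le_trans (ler_wpM2l _ m_le) _ => //.
  rewrite mulrA; apply: ler_wpM2r; first by rewrite invr_ge0 ltW.
  by rewrite /C lerDl.
pose eta := e / 2 ^+ n.+1.
have p2 : (1 : R) <= 2 ^+ n.+1 by rewrite exprn_ege1 // ler1n.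
have p2' : (0 : R) < 2 ^+ n.+1 by lra.
have eta0 : 0 < eta by rewrite divr_gt0.
have eta1 : eta <= 1 by rewrite ler_pdivrMr // mul1r; lra.
have [[deg_w w_ge] w_min w_cG] := wP d.
have w_cube x : cube R n x -> 0 <= peval (w d) x <= cG.
  move=> xK; rewrite (le_trans _ (w_ge x xK)) ?indicE //=.
  by apply: le_trans w_cG; exact: le_max_cube.
have w_X x : semialg h x -> 1 <= peval (w d) x.
  by move=> Xx; have := w_ge x (Xcube x Xx); rewrite indicE mem_set.
have cG1 : 1 <= cG.
  by have /andP[_] := w_cube _ (Xcube _ Xx0); apply: le_trans; exact: w_X.
pose W := w d + eta *: 1.
have WE x : peval W x = peval (w d) x + eta.
  by rewrite /peval mevalD mevalZ meval1 mulr1.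
have W1E x : peval (W - 1) x = peval W x - 1 by rewrite /peval mevalB meval1.
have one_le : (msize (1 : mpoly n R) <= d.+1)%N by rewrite msize1.
have deg_W : deg_le W d.
  rewrite /deg_le (leq_trans (msizeD_le _ _)) // geq_max deg_w /=.
  by rewrite (leq_trans (msizeZ_le _ _)).
have deg_W1 : deg_le (W - 1) d.
  by rewrite /deg_le (leq_trans (msizeD_le _ _)) // geq_max deg_W msizeN.
have degR (p : mpoly n R) : deg_le p d -> (deg p)%:R <= C / e.
  move=> pd; apply: le_trans d_le; rewrite ler_nat /deg -subn1 leq_subLR add1n.
  exact: pd.
have ratioE : (cG + eta) / eta = 1 + 2 ^+ n.+1 * (cG / e).
  by rewrite /eta; field; rewrite !gt_eqF.
have ratio1 : 1 <= (cG + eta) / eta by rewrite ler_pdivlMr //; lra.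
have bound : gamma * (C / e) `^ (7 / 2 * n%:R * Lhat) *
    ((cG + eta) / eta) `^ (5 / 2 * n%:R * Lhat) <= l%:R by rewrite ratioE.
(* For n > 0 both exponents of the bound are nonnegative and the first is at
   least 1, so l is at least C / eps; for n = 0 the degree d is 0. *)
have d_l : (d <= l)%N.
  have [n0|n_gt0] := posnP n; first by rewrite /d n0 muln0 mul0n.
  have n1 : (1 : R) <= n%:R by rewrite ler1n.
  rewrite -(ler_nat R); apply: le_trans d_le (le_trans _ bound).
  have pow1 : C / e <= (C / e) `^ (7 / 2 * n%:R * Lhat).
    by apply: le1r_powR => //; nra.
  have pow2 : 1 <= ((cG + eta) / eta) `^ (5 / 2 * n%:R * Lhat).
    rewrite -[X in X <= _](powRr0 ((cG + eta) / eta)); apply: ler_powR => //.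
    by rewrite !mulr_ge0 //; lra.
  apply: (@le_trans _ _ (1 * (C / e) `^ (7 / 2 * n%:R * Lhat) * 1)).
    by rewrite mul1r mulr1.
  by rewrite ler_pM // ?mulr_ge0 ?powR_ge0 // ler_wpM2r // powR_ge0.
have feasible : [/\ deg_le W l, truncated_quadratic_module h l (W - 1) &
    truncated_quadratic_module (@cube_polys R n) l W].
  split; first by rewrite /deg_le (leq_trans deg_W) // ltnS.
  - apply: (putinar_membership h_putinar L0 LLhat ghG _ eta0 _ _ ratio1 Ce1
      (degR _ deg_W1) bound).
    + by exists x0.
    + by move=> x Xx; rewrite W1E WE; have := w_X _ Xx; lra.
    + apply: max_abs_cube_le => x /w_cube /andP[? ?].
      by rewrite W1E WE ler_norml; lra.
  - apply: (putinar_membership f_putinar ltr01 Lhat1 gfG _ eta0 _ _ ratio1 Ce1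
      (degR _ deg_W) bound).
    + by exists x0; rewrite semialg_cube_polys; exact: Xcube.
    + move=> x; rewrite semialg_cube_polys WE => /w_cube /andP[? ?]; lra.
    + apply: max_abs_cube_le => x /w_cube /andP[? ?].
      by rewrite WE ler_norml; lra.
have [v [vX vI]] := rate m isT.
rewrite lebE lteBlDl //.
apply: (@le_lt_trans _ _ (integral_cube W)).
  by apply: ereal_inf_lbound; exists W.
rewrite integral_cube_addC (_ : eta * 2 ^+ n = e / 2); last first.
  by rewrite /eta exprS; field; rewrite gt_eqF // exprn_gt0.
apply: (@le_lt_trans _ _ (leb R n (semialg h) + (C1 / m%:R)%:E + (e / 2)%:E)%E).
  by rewrite leeD2r // (le_trans (w_min v vX)).
rewrite -addeA lteD2lE // -EFinD lte_fin.
have : C1 / m%:R < e / 2.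
  rewrite ltr_pdivrMr //; move: m_gt; rewrite ltr_pdivrMr // => H; lra.
lra.
Qed.
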